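(* Let $E$ be a countable directed graph. Then the graph $C^*$-algebra $C^*(E)$ is singly generated, i.e. there is an element $x \in C^*(E)$ such that the smallest $C^*$-subalgebra of $C^*(E)$ containing $x$ is $C^*(E)$ itself.
   Context: A directed graph $E=(E^0,E^1,r,s)$ consists of countable (finite or countably infinite) sets $E^0$ (vertices) and $E^1$ (edges) and maps $r,s\colon E^1\to E^0$ (range and source). A Cuntz-Krieger $E$-family in a $C^*$-algebra $A$ consists of mutually orthogonal projections $\{p_v : v\in E^0\}\subseteq A$ and partial isometries $\{s_e : e\in E^1\}\subseteq A$ with mutually orthogonal ranges such that (i) $s_e^*s_e=p_{s(e)}$ for all $e\in E^1$; (ii) $s_es_e^*\le p_{r(e)}$ for all $e\in E^1$; (iii) $p_v=\sum_{r(e)=v}s_es_e^*$ whenever $0<|r^{-1}(v)|<\infty$. The graph $C^*$-algebra $C^*(E)$ is the universal $C^*$-algebra generated by a Cuntz-Krieger $E$-family. $C^*$-algebras are not assumed unital, and generation is in the sense of (not necessarily unital) $C^*$-algebras. *)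

(* Defs.v *)
From mathcomp Require Import all_boot all_order all_algebra.
From mathcomp Require Import complex.
From mathcomp Require Import all_classical all_reals all_analysis.

Set Implicit Arguments.
Unset Strict Implicit.
Unset Printing Implicit Defensive.

Import Order.TTheory GRing.Theory Num.Theory.
Import numFieldNormedType.Exports.

Local Open Scope classical_set_scope.
Local Open Scope ring_scope.
Local Open Scope complex_scope.

(* The library's rings are unital and C*-algebras need not be, so the product
   is added to the complex Banach space by hand; the zero algebra is allowed.
   The norm takes values in R[i], on its nonnegative real half-line. *)
Record cstarAlg (R : realType) := CStarAlg {
  cstar_sort :> completeNormedModType R[i];
  cmul : cstar_sort -> cstar_sort -> cstar_sort;
  cstar : cstar_sort -> cstar_sort;
  cmulA : forall a b c, cmul a (cmul b c) = cmul (cmul a b) c;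
  cmulDl : forall a b c, cmul (a + b) c = cmul a c + cmul b c;
  cmulDr : forall a b c, cmul a (b + c) = cmul a b + cmul a c;
  cmulZl : forall (z : R[i]) a b, cmul (z *: a) b = z *: cmul a b;
  cmulZr : forall (z : R[i]) a b, cmul a (z *: b) = z *: cmul a b;
  cstarK : forall a, cstar (cstar a) = a;
  cstarD : forall a b, cstar (a + b) = cstar a + cstar b;
  cstarZ : forall (z : R[i]) a, cstar (z *: a) = z^* *: cstar a;
  cstarM : forall a b, cstar (cmul a b) = cmul (cstar b) (cstar a);
  cnormM : forall a b, `|cmul a b| <= `|a| * `|b|;
  cnorm_star : forall a, `|cmul (cstar a) a| = `|a| ^+ 2
}.

Declare Scope cstar_scope.
Delimit Scope cstar_scope with CS.
Notation "a ** b" := (cmul a b) (at level 40, left associativity) : cstar_scope.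
Notation "a ^#" := (cstar a) : cstar_scope.
Local Open Scope cstar_scope.

Record is_star_hom (R : realType) (A B : cstarAlg R) (f : A -> B) : Prop := {
  star_homD : forall a b, f (a + b) = f a + f b;
  star_homZ : forall (z : R[i]) a, f (z *: a) = z *: f a;
  star_homM : forall a b, f (a ** b) = f a ** f b;
  star_homS : forall a, f a^# = (f a)^#
}.

Record cstar_subalgebra (R : realType) (A : cstarAlg R) (S : set A) : Prop := {
  cstar_sub0 : S 0;
  cstar_subD : forall a b, S a -> S b -> S (a + b);
  cstar_subZ : forall (z : R[i]) a, S a -> S (z *: a);
  cstar_subM : forall a b, S a -> S b -> S (a ** b);
  cstar_subS : forall a, S a -> S a^#;
  cstar_sub_closed : closed S
}.

Definition cstar_generated (R : realType) (A : cstarAlg R) (X : set A) : set A :=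
  smallest (@cstar_subalgebra R A) X.

Definition is_projection (R : realType) (A : cstarAlg R) (a : A) : Prop :=
  a^# = a /\ a ** a = a.

Definition is_partial_isometry (R : realType) (A : cstarAlg R) (a : A) : Prop :=
  is_projection (a^# ** a).

Definition cstar_le (R : realType) (A : cstarAlg R) (a b : A) : Prop :=
  exists c : A, b - a = c^# ** c.

(* A countType is a finite or countably infinite (possibly empty) type. *)
Record digraph := Digraph {
  vertex : countType;
  edge : countType;
  rng : edge -> vertex;
  src : edge -> vertex
}.

Definition edges_into (E : digraph) (v : vertex E) : set (edge E) :=
  [set e | rng e = v].

Record cuntz_krieger_family (E : digraph) (R : realType) (A : cstarAlg R)
    (p : vertex E -> A) (s : edge E -> A) : Prop := {
  ck_proj : forall v, is_projection (p v);
  ck_proj_orth : forall v w, v <> w -> p v ** p w = 0;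
  ck_pisom : forall e, is_partial_isometry (s e);
  (* The range projection of s e is s e ** (s e)^#. *)
  ck_ranges_orth : forall e f, e <> f ->
    (s e ** (s e)^#) ** (s f ** (s f)^#) = 0;
  ck_source : forall e, (s e)^# ** s e = p (src e);
  ck_range : forall e, cstar_le (s e ** (s e)^#) (p (rng e));
  ck_sum : forall v, edges_into v !=set0 -> finite_set (edges_into v) ->
    p v = \sum_(e \in edges_into v) (s e ** (s e)^#)
}.

(* C*(E) is determined up to isomorphism by its universal property: A with the
   family (p, s) is C*(E). Uniqueness of the homomorphism f follows from
   generation. *)
Record is_graph_cstar_algebra (E : digraph) (R : realType) (A : cstarAlg R)
    (p : vertex E -> A) (s : edge E -> A) : Prop := {
  graph_ck : cuntz_krieger_family p s;
  graph_gen : cstar_generated (range p `|` range s) = [set: A];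
  graph_univ : forall (B : cstarAlg R) (q : vertex E -> B) (t : edge E -> B),
    cuntz_krieger_family q t ->
    exists f : A -> B,
      [/\ is_star_hom f, forall v, f (p v) = q v & forall e, f (s e) = t e]
}.

(* Main.v *)
(* Write q_e = s_e s_e^*. Fix summable weights w decreasing fast along an enumeration.
   Since q_e <= p_(r e), for each vertex v the diagonal D_v = p_v + sum_(r e = v) w_e q_e
   commutes with p_v, and q_e is recovered from D_v^2 and p_v. Orient every pair of
   vertices joined by edges in both directions: an edge f in the wrong direction is back,
   and replaced by the closed path s_(ret f) s_f, where ret f is a return edge in the right
   direction; all other non-loops are direct. Let L_v be the weighted sum of the loops and
   closed paths based at v (or p_v if there are none): they have orthogonal ranges, so
   L_v^* L_v is a positive multiple of p_v. The generator is

     x = sum_v w_v (p_v / 2 + eta L_v D_v) + (Z - Z^* ),   Z = sum of w_e s_e over direct e.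

   Indeed x + x^* = sum_v w_v (p_v + small element of p_v A p_v) gives every p_v, then
   p_v x p_v gives Y_v = L_v D_v, then Y_v^* Y_v = c D_v^2 gives the q_e with range v. As no
   two direct edges run in opposite directions, q_e x p_(s e) = w_e s_e for direct e. Finally
   q_f Y_v, or q_f s_(ret f)^* Y_v, equals w_f s_f D_v, and D_v is invertible in p_v A p_v.

   The order q_e <= p_(r e) is given as p - q = c^* c; that this forces q p = q is the
   positivity theorem in disguise. With d = c q one has d^* d = q p q - q, and approximate
   square roots, taken in the unitization acting on A by left multiplication, give d = 0. *)

From HB Require Import structures.
Require Import Defs.
From mathcomp Require Import all_boot all_order all_algebra.
From mathcomp Require Import complex.
From mathcomp Require Import all_classical all_reals all_analysis.
From mathcomp Require Import ring lra zify.

Set Implicit Arguments.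
Unset Strict Implicit.
Unset Printing Implicit Defensive.

Import Order.TTheory GRing.Theory Num.Theory.
Import numFieldNormedType.Exports.

Local Open Scope classical_set_scope.
Local Open Scope ring_scope.
Local Open Scope complex_scope.
Local Open Scope cstar_scope.

(** * Linear identities in abelian groups *)

Section AbelianReflection.
Variable V : zmodType.

Inductive zexp := ZVar of nat | ZZero | ZAdd of zexp & zexp | ZOpp of zexp.

Fixpoint zeval (env : seq V) (e : zexp) : V :=
  match e with
  | ZVar i => env`_i
  | ZZero => 0
  | ZAdd a b => zeval env a + zeval env b
  | ZOpp a => - zeval env a
  end.

Fixpoint zcoef (e : zexp) (i : nat) : int :=
  match e with
  | ZVar j => (i == j)%:Z
  | ZZero => 0
  | ZAdd a b => zcoef a i + zcoef b i
  | ZOpp a => - zcoef a i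
  end.

Lemma zevalE env e : zeval env e = \sum_(i < size env) env`_i *~ zcoef e i.
Proof.
elim: e => [j||a IHa b IHb|a IHa] /=.
- have [lt_j|ge_j] := ltnP j (size env).
    rewrite (bigD1 (Ordinal lt_j)) //= eqxx big1 ?addr0 // => i.
    by rewrite -val_eqE /= => /negPf ->.
  rewrite nth_default // big1 // => i _.
  by case: eqP => // eq_ij; move: (ltn_ord i); rewrite eq_ij ltnNge ge_j.
- by rewrite big1.
- by rewrite IHa IHb -big_split; apply: eq_bigr => i _; rewrite mulrzDr.
- by rewrite IHa -sumrN; apply: eq_bigr => i _; rewrite mulrNz.
Qed.

(** The integer coefficients of concrete expressions compute, so [abel] discharges this premise by
    evaluation alone. *)
Lemma zevalP env e1 e2 :
  all (fun i => zcoef e1 i == zcoef e2 i) (iota 0 (size env)) ->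
  zeval env e1 = zeval env e2.
Proof.
move=> /allP eq12; rewrite !zevalE; apply: eq_bigr => i _.
by rewrite (eqP (eq12 _ _)) // mem_iota /= add0n ltn_ord.
Qed.

End AbelianReflection.

(* Atoms are compared up to conversion: canonical structures make one and the same
   operation appear in several syntactic forms. *)
Ltac zindex t env :=
  lazymatch env with
  | cons t _ => constr:(0%N)
  | cons ?x ?env' =>
      match goal with
      | _ => let _ := match goal with _ => unify x t end in constr:(0%N)
      | _ => let n := zindex t env' in constr:(n.+1)
      end
  end.
Ltac zmember t env :=
  lazymatch env with
  | nil => constr:(false)
  | cons t _ => constr:(true)
  | cons ?x ?env' =>
      match goal with
      | _ => let _ := match goal with _ => unify x t end in constr:(true)
      | _ => zmember t env'
      end
  end.
Ltac zatoms t env :=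
  lazymatch t with
  | (?a + ?b)%R => let env' := zatoms a env in zatoms b env'
  | (- ?a)%R => zatoms a env
  | 0%R => env
  | _ => lazymatch zmember t env with true => env | false => constr:(cons t env) end
  end.
Ltac zreify t env :=
  lazymatch t with
  | (?a + ?b)%R =>
      let a' := zreify a env in let b' := zreify b env in constr:(ZAdd a' b')
  | (- ?a)%R => let a' := zreify a env in constr:(ZOpp a')
  | 0%R => constr:(ZZero)
  | _ => let n := zindex t env in constr:(ZVar n)
  end.
Ltac abel :=
  lazymatch goal with
  | |- @eq ?T ?l ?r =>
      let env := zatoms l (@nil T) in
      let env := zatoms r env in
      let l' := zreify l env in
      let r' := zreify r env in
      exact: (@zevalP _ env l' r' isT)
  end.

Lemma scale_realD (R : realType) (V : lmodType R[i]) (b c : R) (x : V) :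
  (b + c)%:C *: x = b%:C *: x + c%:C *: x.
Proof. by rewrite rmorphD scalerDl. Qed.

(** * Norm and limits *)

Section Norm.
Variables (R : realType) (A : cstarAlg R).
Implicit Types a b c : A.

(** A real-valued copy of the norm, so that [lra] and [nra] apply to estimates. *)
Definition nrm a : R := complex.Re `|a|.

Lemma nrmE a : `|a| = (nrm a)%:C.
Proof. by rewrite /nrm RRe_real // normr_real. Qed.

Lemma nrm_ge0 a : 0 <= nrm a.
Proof. by rewrite -ler0c -nrmE. Qed.

Lemma nrm0 : nrm 0 = 0.
Proof. by rewrite /nrm normr0. Qed.

Lemma nrm_eq0 a : nrm a = 0 -> a = 0.
Proof. by move=> a0; apply/eqP; rewrite -normr_eq0 nrmE a0. Qed.

Lemma nrmD a b : nrm (a + b) <= nrm a + nrm b.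
Proof. by rewrite -lecR rmorphD /= -!nrmE ler_normD. Qed.

Lemma nrmN a : nrm (- a) = nrm a.
Proof. by rewrite /nrm normrN. Qed.

Lemma nrmB a b : nrm (a - b) <= nrm a + nrm b.
Proof. by rewrite (le_trans (nrmD _ _)) ?nrmN. Qed.

Lemma nrmM a b : nrm (a ** b) <= nrm a * nrm b.
Proof. by rewrite -lecR rmorphM /= -!nrmE cnormM. Qed.

Lemma nrmZ (r : R) a : nrm (r%:C *: a) = `|r| * nrm a.
Proof.
by apply: complexI; rewrite rmorphM /= -!nrmE normrZ normc_def /= expr0n addr0 sqrtr_sqr.
Qed.

Lemma nrm_star_mul a : nrm (a^# ** a) = nrm a ^+ 2.
Proof. by apply: complexI; rewrite rmorphXn /= -!nrmE cnorm_star. Qed.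

(** By the C*-identity the square of [nrm b] is at most [nrm b^# * nrm b]; cancel, then apply this
    to [a] and to [a^#]. *)
Lemma nrm_star a : nrm a^# = nrm a.
Proof.
suff le_star b : nrm b <= nrm b^#.
  by apply/le_anti; rewrite le_star -{2}[a]cstarK le_star.
have := nrmM b^# b; rewrite nrm_star_mul expr2.
have [->|] := eqVneq (nrm b) 0; first by rewrite nrm_ge0.
by move=> nb0; rewrite ler_pM2r // lt_neqAle eq_sym nb0 nrm_ge0.
Qed.

Lemma cstar0 : (0 : A)^# = 0.
Proof. by apply: (addrI (0 : A)^#); rewrite -cstarD !addr0. Qed.

Lemma cstarN a : (- a)^# = - a^#.
Proof. by apply: (addrI a^#); rewrite -cstarD !subrr cstar0. Qed.

Lemma cstarB a b : (a - b)^# = a^# - b^#.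
Proof. by rewrite cstarD cstarN. Qed.

Lemma cstarZr (r : R) a : (r%:C *: a)^# = r%:C *: a^#.
Proof. by rewrite cstarZ conj_Creal ?complex_real. Qed.

Lemma cmul0l a : 0 ** a = 0.
Proof. by apply: (addrI (0 ** a)); rewrite -cmulDl !addr0. Qed.

Lemma cmul0r a : a ** 0 = 0.
Proof. by apply: (addrI (a ** 0)); rewrite -cmulDr !addr0. Qed.

Lemma cmulNl a b : (- a) ** b = - (a ** b).
Proof. by apply: (addrI (a ** b)); rewrite -cmulDl !subrr cmul0l. Qed.

Lemma cmulNr a b : a ** (- b) = - (a ** b).
Proof. by apply: (addrI (a ** b)); rewrite -cmulDr !subrr cmul0r. Qed.

Lemma cmulBl a b c : (a - b) ** c = a ** c - b ** c.
Proof. by rewrite cmulDl cmulNl. Qed.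

Lemma cmulBr a b c : a ** (b - c) = a ** b - a ** c.
Proof. by rewrite cmulDr cmulNr. Qed.

Lemma star_mul_eq0 a : a^# ** a = 0 -> a = 0.
Proof.
move=> aa0; apply: nrm_eq0; apply/eqP; rewrite -sqrf_eq0 -nrm_star_mul aa0.
by rewrite nrm0.
Qed.

Lemma projection_nrm_le1 a : is_projection a -> nrm a <= 1.
Proof.
move=> [aS aa]; have := nrm_star_mul a; rewrite aS aa.
have := nrm_ge0 a; nra.
Qed.

Lemma pisom_nrm_le1 a : is_partial_isometry a -> nrm a <= 1.
Proof.
move=> /projection_nrm_le1; rewrite nrm_star_mul; have := nrm_ge0 a; nra.
Qed.

End Norm.

(** * Convergence of sequences, with real tolerances *)

Section Limits.
Variables (R : realType) (A : cstarAlg R).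
Implicit Types (u v : nat -> A) (l : A).

Definition tends u l :=
  forall e : R, 0 < e -> exists N, forall n, (N <= n)%N -> nrm (u n - l) <= e.

Lemma tends_unique u l l' : tends u l -> tends u l' -> l = l'.
Proof.
move=> ul ul'; apply/eqP; rewrite -subr_eq0; apply/eqP/nrm_eq0/eqP.
rewrite eq_le nrm_ge0 andbT; apply/ler_addgt0Pr => e e0; rewrite add0r.
have [N uN] := ul _ (divr_gt0 e0 (ltr0n _ 2)).
have [N' uN'] := ul' _ (divr_gt0 e0 (ltr0n _ 2)).
have := uN _ (leq_maxl N N'); have := uN' _ (leq_maxr N N').
set w := u _; have -> : l - l' = (w - l') - (w - l) by abel.
have := nrmB (w - l') (w - l); lra.
Qed.

Lemma tends_cauchy u :
  (forall e : R, 0 < e -> exists N, forall n, (N <= n)%N -> nrm (u n - u N) < e) ->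
  exists l, tends u l.
Proof.
move=> cu; have : cauchy (u @ \oo).
  apply: cauchy_exP => e e0.
  have er : e = (complex.Re e)%:C by rewrite RRe_real // gtr0_real.
  have [|N uN] := cu (complex.Re e); first by rewrite -ltcR -er.
  exists (u N); exists N => // n /= Nn.
  by rewrite /= -ball_normE /= -opprB normrN nrmE er ltcR uN.
move=> /cauchy_cvg /cvg_ex [l ul]; exists l => e e0.
have /cvgrPdist_lt /(_ e%:C) := ul; rewrite ltcR => /(_ e0) [N _ uN].
exists N => n Nn; have := uN n Nn; rewrite /= -opprB normrN nrmE ltcR.
exact: ltW.
Qed.

Lemma closed_tends (S : set A) u l :
  closed S -> (forall n, S (u n)) -> tends u l -> S l.
Proof.
move=> clS Su ul; refine (@closed_cvg _ _ \oo _ u S clS _ l _).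
  by exists 0%N => // n _; apply: Su.
apply/cvgrPdist_le => e e0.
have er : e = (complex.Re e)%:C by rewrite RRe_real // gtr0_real.
have [|N uN] := ul (complex.Re e); first by rewrite -ltcR -er.
exists N => // n /= Nn; rewrite -opprB normrN nrmE er lecR.
exact: uN.
Qed.

End Limits.

(** * Weighted sums *)

Section Weights.
Variable R : realType.

(* Small enough for the tail of a weighted sum to be at most 1/20 of the preceding weight,
   the bound required by approx_projection. *)
Definition kap : R := 100%:R^-1.

Lemma kap_gt0 : 0 < kap. Proof. by rewrite invr_gt0. Qed.
Lemma kap_ge0 : 0 <= kap. Proof. exact/ltW/kap_gt0. Qed.
Lemma kap_le1 : kap <= 1. Proof. by rewrite /kap; lra. Qed.

Lemma kapX_gt0 n : 0 < kap ^+ n. Proof. by rewrite exprn_gt0 ?kap_gt0. Qed.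
Lemma kapX_ge0 n : 0 <= kap ^+ n. Proof. exact/ltW/kapX_gt0. Qed.

Lemma kapX_small (e : R) : 0 < e -> exists N, forall n, (N <= n)%N -> kap ^+ n <= e.
Proof.
move=> e0; have /cvgrPdist_le /(_ e e0) [N _ kN] :
  (fun n => kap ^+ n) @ \oo --> (0 : R).
  apply: cvg_expr; rewrite ger0_norm ?kap_ge0 // /kap; lra.
exists N => n /kN; rewrite sub0r normrN ger0_norm //.
exact: kapX_ge0.
Qed.

(** The successor in the exponent makes even the first weight at most [kap]. *)
Definition wgt (I : countType) (i : I) : R := kap ^+ (pickle i).+1.

Lemma wgt_gt0 (I : countType) (i : I) : 0 < wgt i.
Proof. exact: kapX_gt0. Qed.

Lemma wgt_le (I : countType) (i : I) : wgt i <= kap.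
Proof.
by rewrite /wgt exprS ler_piMr ?exprn_ile1 ?kap_ge0 ?kap_le1.
Qed.

End Weights.
Arguments kap {R}.
Arguments wgt {R I} i.

Definition nbounded (R : realType) (A : cstarAlg R) I (u : I -> A) :=
  exists M, forall i, nrm (u i) <= M.

Section WeightedSum.
Variables (R : realType) (I : countType).

Section OneAlgebra.
Variable A : cstarAlg R.
Implicit Types (u v : I -> A) (l : A).

(** Sums run over codes. A number that codes no element contributes 0, which treats finite, empty
    and infinite index types alike. *)
Definition wterm u n : A := oapp (fun i => (kap ^+ n.+1)%:C *: u i) 0 (pickle_inv n).

Definition psum u n : A := \sum_(m < n) wterm u m.

Definition csum u : A := xget 0 [set l | tends (psum u) l].

Lemma wterm_bound u M n : (forall i, nrm (u i) <= M) -> 0 <= M ->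
  nrm (wterm u n) <= kap ^+ n.+1 * M.
Proof.
move=> uM M0; rewrite /wterm; case: pickle_inv => [i|] /=.
  rewrite nrmZ ger0_norm ?ler_wpM2l ?kapX_ge0 //.
by rewrite nrm0 mulr_ge0 // kapX_ge0.
Qed.

(** The factor 2 makes the geometric bound telescope: a term [kap ^+ n.+1] is at most twice
    [kap ^+ n.+1 - kap ^+ n.+2]. *)
Lemma psum_tail u M m n : (forall i, nrm (u i) <= M) -> 0 <= M -> (m <= n)%N ->
  nrm (psum u n - psum u m) <= 2 * M * (kap ^+ m.+1 - kap ^+ n.+1).
Proof.
move=> uM M0; elim: n => [|n IHn].
  by rewrite leqn0 => /eqP ->; rewrite !subrr nrm0 mulr0.
rewrite leq_eqVlt => /orP[/eqP -> | /IHn le_n].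
  by rewrite !subrr nrm0 mulr0.
rewrite /psum big_ord_recr /= -/(psum u n).
have -> : psum u n + wterm u n - psum u m = (psum u n - psum u m) + wterm u n
  by abel.
apply: le_trans (nrmD _ _) _.
have := wterm_bound n uM M0; have := kapX_gt0 R n.+1.
rewrite [kap ^+ n.+2]exprS; set x := kap ^+ n.+1 in le_n *; rewrite /kap; nra.
Qed.

Lemma csumP u : nbounded u -> tends (psum u) (csum u).
Proof.
move=> [M uM]; have M1_ge0 : 0 <= `|M| + 1 by rewrite addr_ge0.
have uM1 i : nrm (u i) <= `|M| + 1.
  by apply: le_trans (uM i) _; have := ler_norm M; lra.
have [] := @tends_cauchy _ _ (psum u).
  move=> e e0; have e'0 : 0 < e / (2 * (`|M| + 1) + 1) by rewrite divr_gt0 //; lra.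
  have [N kN] := kapX_small e'0; exists N => n Nn.
  apply: le_lt_trans (psum_tail uM1 M1_ge0 Nn) _.
  have := kN N.+1 (leqnSn _); rewrite ler_pdivlMr; last lra.
  have := kapX_gt0 R N.+1; have := kapX_gt0 R n.+1; nra.
by move=> l ul; rewrite /csum; case: xgetP => [? -> //|/(_ l)].
Qed.

Lemma csum_unique u l : nbounded u -> tends (psum u) l -> csum u = l.
Proof. by move=> /csumP; apply: tends_unique. Qed.

(** Only the tail from [n] on survives. With [n] just past the code of [i], the bound is of order
    [kap * wgt i], hence small relative to the weight of [i]. *)
Lemma csum_bound u M n : (forall i, nrm (u i) <= M) -> 0 <= M ->
  (forall i, (pickle i < n)%N -> u i = 0) -> nrm (csum u) <= 2 * M * kap ^+ n.+1.
Proof.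
move=> uM M0 u0; have ub : nbounded u by exists M.
have pu0 : psum u n = 0.
  rewrite /psum big1 // => m _; rewrite /wterm.
  case Em: pickle_inv => [i|] //=.
  have := @pickle_invK I m; rewrite /= Em /= => im.
  by rewrite u0 ?scaler0 // im.
apply/ler_addgt0Pr => e /(csumP ub) [N uN].
have := uN _ (leq_maxl N n).
have := psum_tail uM M0 (leq_maxr N n); rewrite pu0 subr0.
set w := psum u _ => wM we.
have -> : csum u = w - (w - csum u) by abel.
apply: le_trans (nrmB _ _) _; apply: lerD => //; apply: le_trans wM _.
rewrite ler_wpM2l ?mulr_ge0 // gerBl; exact: kapX_ge0.
Qed.

Lemma csum_bound0 u M : (forall i, nrm (u i) <= M) -> 0 <= M ->
  nrm (csum u) <= M.
Proof.
move=> uM M0; apply: le_trans (csum_bound (n := 0) uM M0 _) _ => //.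
by rewrite expr1 /kap; lra.
Qed.

Lemma csumD u v : nbounded u -> nbounded v ->
  csum (fun i => u i + v i) = csum u + csum v.
Proof.
move=> bu bv; apply: csum_unique.
  have [[M uM] [M' vM']] := (bu, bv); exists (M + M') => i.
  by apply: le_trans (nrmD _ _) _; apply: lerD.
have psumD n : psum (fun i => u i + v i) n = psum u n + psum v n.
  rewrite /psum -big_split; apply: eq_bigr => m _; rewrite /wterm.
  by case: pickle_inv => [i|] /=; rewrite ?scalerDr ?addr0.
move=> e e0; have e2 : 0 < e / 2 by lra.
have [N uN] := csumP bu e2; have [N' vN'] := csumP bv e2.
exists (maxn N N') => n; rewrite geq_max => /andP[/uN + /vN'].
rewrite psumD.
have -> : psum u n + psum v n - (csum u + csum v) =
   (psum u n - csum u) + (psum v n - csum v) by abel.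
have := nrmD (psum u n - csum u) (psum v n - csum v); lra.
Qed.

Lemma csum1 u i : (forall j, j != i -> u j = 0) -> csum u = (wgt i)%:C *: u i.
Proof.
move=> u0; apply: csum_unique.
  exists (nrm (u i)) => j; have [-> //|/u0 ->] := eqVneq j i.
  by rewrite nrm0 nrm_ge0.
move=> e e0; exists (pickle i).+1 => n lt_n.
rewrite (_ : psum u n = (wgt i)%:C *: u i) ?subrr ?nrm0 ?(ltW e0) //.
rewrite /psum (bigD1 (Ordinal lt_n)) //= /wterm pickleK_inv /= big1 ?addr0 //.
move=> m; rewrite -val_eqE /= => m_i; case Em: pickle_inv => [j|] //=.
rewrite u0 ?scaler0 //; apply: contraNneq m_i => <-.
by have := @pickle_invK I m; rewrite /= Em /= => ->.
Qed.

Lemma csum0 u : (forall i, u i = 0) -> csum u = 0.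
Proof.
move=> u0; apply: csum_unique; first by exists 0 => i; rewrite u0 nrm0.
move=> e e0; exists 0%N => n _; rewrite /psum big1 ?subrr ?nrm0 ?(ltW e0) //.
by move=> m _; rewrite /wterm; case: pickle_inv => //= i; rewrite u0 scaler0.
Qed.

Lemma csum_mem (S : set A) u : cstar_subalgebra S -> nbounded u ->
  (forall i, S (u i)) -> S (csum u).
Proof.
move=> subS /csumP u_cvg Su.
apply: (closed_tends (cstar_sub_closed subS) _ u_cvg) => n.
rewrite /psum; apply: big_ind => //; [exact: cstar_sub0 | exact: cstar_subD|].
move=> m _; rewrite /wterm; case: pickle_inv => [i|] /=; last exact: cstar_sub0.
exact: cstar_subZ.
Qed.

End OneAlgebra.

(* Real homogeneity is all that is required of f, so that the involution is covered. *)
Lemma csum_map (A B : cstarAlg R) (f : A -> B) (u : I -> A) (K : R) :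
  (forall a b, f (a + b) = f a + f b) ->
  (forall (r : R) a, f (r%:C *: a) = r%:C *: f a) ->
  (forall a, nrm (f a) <= K * nrm a) -> 0 <= K -> nbounded u ->
  f (csum u) = csum (fun i => f (u i)).
Proof.
move=> fD fZ fK K0 bu.
have f0 : f 0 = 0 by apply: (addrI (f 0)); rewrite -fD !addr0.
have fB a b : f (a - b) = f a - f b.
  by apply: (addIr (f b)); rewrite -fD !addrNK.
apply/esym/csum_unique.
  have [M uM] := bu; exists (K * M) => i; apply: le_trans (fK _) _.
  exact: ler_wpM2l.
have f_psum n : psum (fun i => f (u i)) n = f (psum u n).
  rewrite /psum (big_morph f fD f0); apply: eq_bigr => m _; rewrite /wterm.
  by case: pickle_inv => //= i; rewrite fZ.
(* [K] may be 0, so the tolerance is divided by [K + 1]. *)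
move=> e e0; have e'0 : 0 < e / (K + 1) by rewrite divr_gt0 //; lra.
have [N uN] := csumP bu e'0; exists N => n /uN.
rewrite f_psum -fB; have := fK (psum u n - csum u).
rewrite ler_pdivlMr; last lra.
have := nrm_ge0 (psum u n - csum u); nra.
Qed.

Variable A : cstarAlg R.
Implicit Types (u : I -> A) (a : A).

Lemma csumMl a u : nbounded u -> a ** csum u = csum (fun i => a ** u i).
Proof.
move=> bu; apply: (csum_map (f := cmul a) (K := nrm a)) => //.
- exact: cmulDr.
- by move=> r b; rewrite cmulZr.
- by move=> b; apply: nrmM.
- exact: nrm_ge0.
Qed.

Lemma csumMr a u : nbounded u -> csum u ** a = csum (fun i => u i ** a).
Proof.
move=> bu; apply: (csum_map (f := fun b => b ** a) (K := nrm a)) => //.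
- by move=> b c; apply: cmulDl.
- by move=> r b; rewrite cmulZl.
- by move=> b; rewrite mulrC; apply: nrmM.
- exact: nrm_ge0.
Qed.

Lemma csumS u : nbounded u -> (csum u)^# = csum (fun i => (u i)^#).
Proof.
move=> bu; apply: (csum_map (f := @cstar _ A) (K := 1)) => //.
- exact: cstarD.
- exact: cstarZr.
- by move=> b; rewrite mul1r nrm_star.
Qed.

Lemma csumZ (r : R) u : nbounded u -> r%:C *: csum u = csum (fun i => r%:C *: u i).
Proof.
move=> bu; apply: (csum_map (f := fun b : A => r%:C *: b) (K := `|r|)) => //.
- by move=> b c; rewrite scalerDr.
- by move=> s b; rewrite !scalerA mulrC.
- by move=> b; rewrite nrmZ.
Qed.

End WeightedSum.

(** * Recovering projections from a weighted sum *)

Section RecoverProjections.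
Variables (R : realType) (A : cstarAlg R) (S : set A).
Hypothesis subS : cstar_subalgebra S.

Lemma subalgZ (r : R) a : S a -> S (r%:C *: a).
Proof. exact: cstar_subZ. Qed.

Lemma subalgN a : S a -> S (- a).
Proof. by move=> Sa; rewrite -scaleN1r; apply: cstar_subZ. Qed.

Lemma subalgB a b : S a -> S b -> S (a - b).
Proof. by move=> Sa Sb; apply: cstar_subD => //; apply: subalgN. Qed.

Lemma subalg_scale_inv (r : R) a : r != 0 -> S (r%:C *: a) -> S a.
Proof.
move=> r0 /(subalgZ r^-1); rewrite scalerA -rmorphM /= mulVf // scale1r.
by [].
Qed.

(* One step of the iteration y |-> 3 y^2 - 2 y^3, which contracts quadratically to the
   idempotent. *)
Lemma approx_projection_step (e r : A) : e ** e = e -> e ** r = r ** e ->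
  nrm e <= 1 -> nrm r <= 20%:R^-1 -> S (e + r) ->
  exists r', [/\ e ** r' = r' ** e, nrm r' <= 2^-1 * nrm r & S (e + r')].
Proof.
move=> ee er e1 r1 Sy; set y := e + r.
have Sy2 : S (y ** y) by apply: cstar_subM.
have Sy3 : S (y ** y ** y) by apply: cstar_subM.
have y2E : y ** y = e + (e ** r + e ** r) + r ** r.
  rewrite /y cmulDl !cmulDr ee -er; abel.
have err : r ** (e ** r) = e ** (r ** r) by rewrite cmulA -er cmulA.
have y3E : y ** y ** y = e + (e ** r + e ** r + e ** r) +
    (e ** (r ** r) + e ** (r ** r) + e ** (r ** r)) + r ** (r ** r).
  have eer : e ** (e ** r) = e ** r by rewrite cmulA ee.
  by rewrite y2E /y !cmulDl !cmulDr -!cmulA -!er eer err ee; abel.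
set r2 := r ** r in y2E y3E *; set r3 := r ** r2 in y3E *.
(* This is [3 y^2 - 2 y^3 - e]: the terms linear in [r] have cancelled. *)
exists (r2 + r2 + r2 - (e ** r2 + e ** r2 + e ** r2 + e ** r2 + e ** r2 + e ** r2) - (r3 + r3)).
have er2 : e ** r2 = r2 ** e by rewrite /r2 cmulA er -cmulA er cmulA.
have er3 : e ** r3 = r3 ** e by rewrite /r3 cmulA er -cmulA er2 cmulA.
have n2 : nrm r2 <= nrm r * nrm r by apply: nrmM.
have n3 : nrm r3 <= nrm r * (nrm r * nrm r).
  by apply: le_trans (nrmM _ _) _; rewrite ler_wpM2l ?nrm_ge0.
clearbody r2 r3; have eer2 : e ** (e ** r2) = e ** r2 ** e by rewrite -cmulA er2.
split.
- by rewrite !cmulBr !cmulBl !cmulDr !cmulDl er3 eer2 !er2.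
- have n4 : nrm (e ** r2) <= nrm r * nrm r.
    apply: le_trans (nrmM _ _) _; rewrite -[leRHS]mul1r ler_pM ?nrm_ge0 //.
  set f := e ** r2 in n4 *.
  have nf3 : nrm (f + f + f) <= 3 * nrm f.
    by have := nrmD (f + f) f; have := nrmD f f; lra.
  have nf6 : nrm (f + f + f + f + f + f) <= 6 * nrm f.
    have -> : f + f + f + f + f + f = (f + f + f) + (f + f + f) by abel.
    by have := nrmD (f + f + f) (f + f + f); lra.
  have nr2 : nrm (r2 + r2 + r2) <= 3 * nrm r2.
    by have := nrmD (r2 + r2) r2; have := nrmD r2 r2; lra.
  have nr3 := nrmD r3 r3.
  (* With [t = nrm r <= 1/20], the new error is at most [9 t^2 + 2 t^3 <= (9/20 + 2/400) t], less
     than [t / 2]. *)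
  have := nrmB (r2 + r2 + r2 - (f + f + f + f + f + f)) (r3 + r3).
  have := nrmB (r2 + r2 + r2) (f + f + f + f + f + f).
  have := nrm_ge0 r; set t := nrm r in n2 n3 n4 r1 * => t0.
  have : t * (t * t) <= 20%:R^-1 * (t * t) by nra.
  have : t * t <= 20%:R^-1 * t by nra.
  lra.
- have -> : e + (r2 + r2 + r2 - (e ** r2 + e ** r2 + e ** r2 + e ** r2 + e ** r2 + e ** r2)
      - (r3 + r3)) = y ** y + y ** y + y ** y - (y ** y ** y + y ** y ** y).
    by rewrite y3E y2E; abel.
  apply: subalgB; first do 2?apply: cstar_subD => //.
  exact: cstar_subD.
Qed.

(** Iterating the step halves the error each time without leaving [S], which is closed. *)
Lemma approx_projection (e r : A) : e ** e = e -> e ** r = r ** e ->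
  nrm e <= 1 -> nrm r <= 20%:R^-1 -> S (e + r) -> S e.
Proof.
move=> ee er e1 r1 Sy.
have step n : exists r' : A, [/\ e ** r' = r' ** e,
    nrm r' <= 2^-1 ^+ n * 20%:R^-1 & S (e + r')].
  elim: n => [|n [r' [er' r'n Sr']]]; first by exists r; rewrite expr0 mul1r.
  have r'1 : nrm r' <= 20%:R^-1.
    apply: le_trans r'n _; rewrite ler_piMl ?exprn_ile1 //; lra.
  have [r'' [er'' r''n Sr'']] := approx_projection_step ee er' e1 r'1 Sr'.
  by exists r''; split=> //; rewrite exprS; lra.
have /choice[t tP] := step.
apply: (closed_tends (u := fun n => e + t n) (cstar_sub_closed subS)).
  by move=> n; have [] := tP n.
move=> d d0; have /cvgrPdist_le /(_ d d0) [N _ kN] :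
  (fun n => 2^-1 ^+ n) @ \oo --> (0 : R).
  by apply: cvg_expr; rewrite ger0_norm; lra.
exists N => n /kN; rewrite sub0r normrN ger0_norm ?exprn_ge0 // addrC addKr => nd.
have [_ tn _] := tP n; apply: le_trans tn _; apply: le_trans nd.
rewrite ler_piMr ?exprn_ge0 //; lra.
Qed.

Variable I : countType.

(** Strong induction along the enumeration. The terms before [i] lie in [S], being cut out of the
    sum by the projections already found, and are subtracted. Divided by [wgt i], the rest is [e i]
    plus [r i] plus a tail that [e i] annihilates on both sides, so [approx_projection] applies. *)
Lemma extract_projections (e r : I -> A) :
  (forall i, is_projection (e i)) -> (forall i j, i != j -> e i ** e j = 0) ->
  (forall i, e i ** r i = r i) -> (forall i, r i ** e i = r i) ->
  (forall i, nrm (r i) <= 100%:R^-1) ->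
  S (csum (fun i => e i + r i)) -> forall i, S (e i).
Proof.
move=> eP e_orth er re r_small Ssum i.
set u := fun i => e i + r i in Ssum.
have u_bd j : nrm (u j) <= 101%:R / 100%:R.
  apply: le_trans (nrmD _ _) _; have := r_small j.
  have := projection_nrm_le1 (eP j); lra.
have bu : nbounded u by exists (101%:R / 100%:R).
have bcond (P : pred I) : nbounded (fun j => if P j then u j else 0).
  exists (101%:R / 100%:R) => j; case: ifP => // _; rewrite nrm0; lra.
have eu j k : j != k -> e j ** u k = 0.
  by move=> jk; rewrite /u cmulDr -er cmulA e_orth // cmul0l addr0.
have ue j k : j != k -> u k ** e j = 0.
  by move=> jk; rewrite /u cmulDl -re -cmulA e_orth 1?eq_sym // cmul0r addr0.
have sum_e j : csum u ** e j = (wgt j)%:C *: u j.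
  rewrite csumMr // (csum1 (i := j)); last by move=> k kj; rewrite ue // eq_sym.
  by rewrite {1}/u cmulDl re (eP j).2.
have [n] := ubnP (pickle i); elim: n i => // n IHn i; rewrite ltnS => le_in.
pose lo (j : I) := (pickle j < pickle i)%N.
pose hi (j : I) := (pickle j > pickle i)%N.
set ulo := fun j => if lo j then u j else 0.
set uhi := fun j => if hi j then u j else 0.
set umid := fun j => if j == i then u j else 0.
have usplit : csum u = csum ulo + (csum umid + csum uhi).
  rewrite -(csumD (bcond (pred1 i)) (bcond hi)) -(csumD (bcond lo)); last first.
    exists (101%:R / 100%:R + 101%:R / 100%:R) => j; apply: le_trans (nrmD _ _) _.
    by apply: lerD; case: ifP => // _; rewrite nrm0; lra.
  congr csum; apply/funext => j; rewrite /= /lo /hi.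
  have [->|ji] := eqVneq j i; first by rewrite ltnn add0r addr0.
  have pji : pickle j != pickle i.
    by apply: contra ji => /eqP /(pcan_inj pickleK) ->.
  by case: ltngtP pji => // _ _; rewrite ?addr0 ?add0r.
have Slo : S (csum ulo).
  apply: csum_mem => //; first exact: (bcond lo).
  move=> j; rewrite /ulo /lo; case: ifP => [ji|_]; last exact: cstar_sub0.
  apply: (@subalg_scale_inv (wgt j)); first by rewrite gt_eqF // wgt_gt0.
  rewrite -sum_e; apply: cstar_subM => //; apply: IHn.
  exact: leq_trans ji le_in.
have mid : csum umid = (wgt i)%:C *: u i.
  rewrite (csum1 (i := i)) /umid ?eqxx // => j /negPf -> //.
set h := (wgt i)^-1%:C *: csum uhi.
have wi0 : wgt i != 0 :> R by rewrite gt_eqF // wgt_gt0.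
have Sb : S (e i + (r i + h)).
  apply: (@subalg_scale_inv (wgt i)) => //.
  have -> : (wgt i)%:C *: (e i + (r i + h)) = csum u - csum ulo.
    rewrite addrA -/(u i) scalerDr /h scalerA -rmorphM /= mulfV // scale1r usplit mid.
    by set w := _ *: u i; abel.
  exact: subalgB.
have ehi : e i ** csum uhi = 0.
  rewrite csumMl; [rewrite csum0 // => j; rewrite /uhi /hi|exact: (bcond hi)].
  case: ifP => [ij|_]; last by rewrite cmul0r.
  by rewrite eu //; apply: contraTneq ij => ->; rewrite ltnn.
have hie : csum uhi ** e i = 0.
  rewrite csumMr; [rewrite csum0 // => j; rewrite /uhi /hi|exact: (bcond hi)].
  case: ifP => [ij|_]; last by rewrite cmul0l.
  by rewrite ue //; apply: contraTneq ij => ->; rewrite ltnn.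
apply: (approx_projection (r := r i + h)) => //.
- exact: (eP i).2.
- by rewrite cmulDr cmulDl er re /h cmulZr cmulZl ehi hie.
- exact: projection_nrm_le1.
(* Codes in the tail exceed that of [i], so it has a factor [kap ^+ (pickle i).+2 = kap * wgt i].
   After division it is at most 2.02/100, and with [r i] the error is at most 3.02/100, below
   1/20. *)
have : nrm (csum uhi) <= 2 * (101%:R / 100%:R) * kap ^+ (pickle i).+2.
  apply: csum_bound; [|lra|].
    by move=> j; rewrite /uhi; case: ifP => // _; rewrite nrm0; lra.
  by move=> j; rewrite /uhi /hi; case: ifP => //; lia.
have nh : nrm h = (wgt i)^-1 * nrm (csum uhi).
  by rewrite /h nrmZ ger0_norm // invr_ge0 ltW // wgt_gt0.
rewrite exprS -/(wgt i) => hi_bd.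
have : nrm h <= 2 * (101%:R / 100%:R) * kap.
  by rewrite nh ler_pdivrMl ?wgt_gt0 //; apply: le_trans hi_bd _; rewrite [leRHS]mulrC !mulrA.
have := nrmD (r i) h; have := r_small i; rewrite /kap; lra.
Qed.

End RecoverProjections.

(** * The unitization and approximate square roots *)

(** A unit is adjoined even if [A] already has one or is zero, so that [1 != 0] always holds. The
    separate name lets the pair type carry the product [umul]. *)
Definition unitization (R : realType) (A : cstarAlg R) : Type := (R[i] * A)%type.

Section UnitizationRing.
Variables (R : realType) (A : cstarAlg R).
Local Notation U := (unitization A).

HB.instance Definition _ := GRing.Lmodule.copy U (R[i] * A)%type.

Definition umul (x y : U) : U := (x.1 * y.1, x.1 *: y.2 + y.1 *: x.2 + x.2 ** y.2).
Definition uone : U := (1, 0).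

Lemma umulA : associative umul.
Proof.
move=> [x a] [y b] [z c]; rewrite /umul /=; congr pair; first by rewrite mulrA.
rewrite !cmulDl !cmulDr !cmulZl !cmulZr !scalerDr !scalerA cmulA.
rewrite [z * x]mulrC [z * y]mulrC; abel.
Qed.
Lemma umul1r : left_id uone umul.
Proof.
by move=> [x a]; rewrite /umul /= mul1r scale1r scaler0 addr0 cmul0l addr0.
Qed.
Lemma umulr1 : right_id uone umul.
Proof.
by move=> [x a]; rewrite /umul /= mulr1 scale1r scaler0 add0r cmul0r addr0.
Qed.
Lemma umulDl : left_distributive umul +%R.
Proof.
move=> [x a] [y b] [z c]; rewrite /umul /=; congr pair; first exact: mulrDl.
by rewrite /= !cmulDl scalerDr scalerDl; abel.
Qed.
Lemma umulDr : right_distributive umul +%R.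
Proof.
move=> [x a] [y b] [z c]; rewrite /umul /=; congr pair; first exact: mulrDr.
by rewrite /= !cmulDr scalerDr scalerDl; abel.
Qed.
Lemma uone_neq0 : uone != 0.
Proof. by apply/eqP => -[/eqP]; rewrite oner_eq0. Qed.

HB.instance Definition _ := GRing.Zmodule_isNzRing.Build U
  umulA umul1r umulr1 umulDl umulDr uone_neq0.

Lemma uscaleAl (z : R[i]) (x y : U) : z *: (x * y) = (z *: x) * y.
Proof.
congr pair; first exact: mulrA.
by rewrite /= !scalerDr !scalerA cmulZl [z * y.1]mulrC.
Qed.

HB.instance Definition _ := GRing.Lmodule_isLalgebra.Build R[i] U uscaleAl.

Lemma uscaleAr (z : R[i]) (x y : U) : z *: (x * y) = x * (z *: y).
Proof.
congr pair; first exact: mulrCA.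
by rewrite /= !scalerDr !scalerA cmulZr [z * x.1]mulrC.
Qed.

HB.instance Definition _ := GRing.Lalgebra_isAlgebra.Build R[i] U uscaleAr.

End UnitizationRing.

(** * The unitization acting on [A], and its operator bounds *)

Section UnitizationNorm.
Variables (R : realType) (A : cstarAlg R).
Local Notation U := (unitization A).
Implicit Types (x y z : U) (a b : A) (M N : R).

Definition uin a : U := (0, a).

Definition ustar x : U := (x.1^*, x.2^#).

Definition uact x a : A := x.1 *: a + x.2 ** a.

Lemma uinM a b : uin (a ** b) = uin a * uin b.
Proof. by congr pair; rewrite /= ?mulr0 // !scale0r !add0r. Qed.

Lemma uinB a b : uin (a - b) = uin a - uin b.
Proof. by congr pair; rewrite /= subr0. Qed.

Lemma uin_star a : ustar (uin a) = uin a^#.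
Proof. congr pair; exact: conjC0. Qed.

Lemma ustarK : involutive ustar.
Proof. move=> [z a]; congr pair; [exact: conjCK | exact: cstarK]. Qed.

Lemma ustarD x y : ustar (x + y) = ustar x + ustar y.
Proof. congr pair; [exact: rmorphD | exact: cstarD]. Qed.

Lemma ustarZ (c : R[i]) x : ustar (c *: x) = c^* *: ustar x.
Proof. congr pair; [exact: rmorphM | exact: cstarZ]. Qed.

Lemma ustarM x y : ustar (x * y) = ustar y * ustar x.
Proof.
congr pair; first by rewrite [LHS]rmorphM mulrC.
by rewrite /= !cstarD !cstarZ cstarM; abel.
Qed.

Lemma ustar1 : ustar 1 = 1.
Proof. congr pair; [exact: conjC1 | exact: cstar0]. Qed.

Lemma ustarN x : ustar (- x) = - ustar x.
Proof. by rewrite -scaleN1r ustarZ rmorphN rmorph1 scaleN1r. Qed.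

Lemma ustarB x y : ustar (x - y) = ustar x - ustar y.
Proof. by rewrite ustarD ustarN. Qed.

Lemma uact1 a : uact 1 a = a.
Proof. by rewrite /uact /= scale1r cmul0l addr0. Qed.

Lemma uactM x y a : uact (x * y) a = uact x (uact y a).
Proof.
rewrite /uact /= !scalerDr !cmulDl !cmulDr !cmulZl !cmulZr !scalerA cmulA.
by abel.
Qed.

Lemma uactD x y a : uact (x + y) a = uact x a + uact y a.
Proof. by rewrite /uact /= scalerDl cmulDl; abel. Qed.

Lemma uactZ (c : R[i]) x a : uact (c *: x) a = c *: uact x a.
Proof. by rewrite /uact /= scalerDr scalerA cmulZl. Qed.

(** Adjointness for the [A]-valued inner product [a^# ** b], which takes the place of a Hilbert
    space. *)
Lemma uact_adjoint x a b : (uact x a)^# ** b = a^# ** uact (ustar x) b.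
Proof.
by rewrite /uact /= cstarD cstarZ cstarM cmulDl cmulDr cmulZl cmulZr cmulA.
Qed.

(** A bound for the operator seminorm only: if [A] has a unit [u], then [(1, - u)] acts as zero. On
    [A] itself the action is faithful, by [uin_bnd0]. *)
Definition ubnd M x := forall a, nrm (uact x a) <= M * nrm a.

Lemma ubnd_le M N x : M <= N -> ubnd M x -> ubnd N x.
Proof.
by move=> MN bx a; apply: le_trans (bx a) _; rewrite ler_wpM2r ?nrm_ge0.
Qed.

Lemma ubnd1 : ubnd 1 1.
Proof. by move=> a; rewrite uact1 mul1r. Qed.

Lemma ubndD M N x y : ubnd M x -> ubnd N y -> ubnd (M + N) (x + y).
Proof.
move=> bx by_ a; rewrite uactD mulrDl; apply: le_trans (nrmD _ _) _.
exact: lerD.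
Qed.

Lemma ubndZ (c : R) M x : ubnd M x -> ubnd (`|c| * M) (c%:C *: x).
Proof. by move=> bx a; rewrite uactZ nrmZ -mulrA ler_wpM2l. Qed.

Lemma ubndi M x : ubnd M x -> ubnd M ('i *: x).
Proof.
move=> bx a; apply: le_trans (bx a); rewrite uactZ /nrm normrZ.
by rewrite normCi mul1r.
Qed.

Lemma ubndN M x : ubnd M x -> ubnd M (- x).
Proof.
move=> bx a; apply: le_trans (bx a).
by rewrite -scaleN1r uactZ scaleN1r nrmN.
Qed.

Lemma ubndB M N x y : ubnd M x -> ubnd N y -> ubnd (M + N) (x - y).
Proof. by move=> bx /ubndN; apply: ubndD. Qed.

Lemma ubndM M N x y : 0 <= M -> ubnd M x -> ubnd N y -> ubnd (M * N) (x * y).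
Proof.
move=> M0 bx by_ a; rewrite uactM; apply: le_trans (bx _) _.
by rewrite -mulrA ler_wpM2l.
Qed.

Lemma ubnd_half M x : ubnd M (x + x) -> ubnd (M / 2) x.
Proof.
move=> bxx a; have := bxx a; rewrite uactD.
have -> : uact x a + uact x a = (2 : R)%:C *: uact x a.
  by rewrite (_ : (2 : R)%:C = 1 + 1) ?scalerDl ?scale1r // -rmorphD.
rewrite nrmZ ger0_norm //; lra.
Qed.

(** Lets the errors of approximate square roots tend to 0; the restriction [e <= 1] allows terms in
    [e ^+ 2] to be absorbed into [K * e]. *)
Lemma ubnd_lim (K M : R) x :
  (forall e : R, 0 < e -> e <= 1 -> ubnd (M + K * e) x) -> ubnd M x.
Proof.
move=> bx a; apply/ler_addgt0Pr => d d0.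
set C := (`|K| + 1) * (nrm a + 1).
have a0 := nrm_ge0 a; have K0 := normr_ge0 K.
have C0 : 1 <= C by rewrite /C; nra.
(* Chosen to give both [e <= 1] and [e * C <= d], where [C] dominates [K * nrm a]. *)
set e := d / (C + d).
have Cd : 0 < C + d by lra.
have e0 : 0 < e by rewrite divr_gt0.
have e1 : e <= 1 by rewrite ler_pdivrMr //; lra.
apply: le_trans (bx e e0 e1 a) _; rewrite mulrDl lerD2l.
have eC : e * C <= d.
  rewrite /e mulrAC ler_pdivrMr // ler_pM2l //; lra.
apply: le_trans eC; rewrite mulrAC mulrC ler_pM2l // /C.
have : K * nrm a <= `|K| * nrm a by rewrite ler_wpM2r // ler_norm.
by rewrite mulrDl mulrDr mul1r mulr1; lra.
Qed.

(** For [b = uact (ustar x) a], adjointness turns [b^# ** b] into [a^# ** uact x b]; then one factor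
    [nrm b] cancels. *)
Lemma ubnd_star M x : ubnd M x -> ubnd M (ustar x).
Proof.
move=> bx a; set b := uact (ustar x) a.
have : nrm b ^+ 2 <= nrm a * (M * nrm b).
  rewrite -nrm_star_mul /b uact_adjoint ustarK -/b.
  apply: le_trans (nrmM _ _) _; rewrite nrm_star ler_wpM2l ?nrm_ge0 //.
have [->|b0] := eqVneq (nrm b) 0.
  move=> _; have := bx a; have := nrm_ge0 (uact x a); lra.
have : 0 < nrm b by rewrite lt_neqAle eq_sym b0 nrm_ge0.
move=> b_gt0; rewrite expr2 mulrA ler_pM2r //; lra.
Qed.

(** The C*-inequality for the action: the square of [uact x a] is [a^# ** uact (ustar x * x) a]. *)
Lemma ubnd_cstar M x : 0 <= M -> ubnd (M ^+ 2) (ustar x * x) -> ubnd M x.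
Proof.
move=> M0 bxx a; rewrite -(@ler_pXn2r _ 2) ?nnegrE ?mulr_ge0 ?nrm_ge0 //.
rewrite -nrm_star_mul uact_adjoint -uactM; apply: le_trans (nrmM _ _) _.
rewrite nrm_star; apply: le_trans (ler_wpM2l (nrm_ge0 a) (bxx a)) _.
by rewrite (_ : nrm a * _ = (M * nrm a) ^+ 2) //; ring.
Qed.

Lemma ubnd_uin a : ubnd (nrm a) (uin a).
Proof. by move=> b; rewrite /uact scale0r add0r nrmM. Qed.

Lemma uin_bnd0 a : ubnd 0 (uin a) -> a = 0.
Proof.
move=> /(_ a^#); rewrite /uact scale0r add0r mul0r /= => le0.
rewrite -[a]cstarK (@star_mul_eq0 _ _ a^#) ?cstar0 // cstarK.
by apply: nrm_eq0; apply/le_anti; rewrite le0 nrm_ge0.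
Qed.

End UnitizationNorm.

(** * Approximate square roots and a norm criterion for positivity *)

Section SquareRoot.
Variables (R : realType) (A : cstarAlg R).
Local Notation U := (unitization A).
Implicit Types (x y z : U).

(* Visser's iteration: u_n is a polynomial in z with nonnegative coefficients and
   (1 - u_n)^2 - (1 - z) = 2 (u_(n+1) - u_n). *)
Fixpoint visser z n : U :=
  if n is m.+1 then (2^-1 : R)%:C *: (z + visser z m * visser z m) else 0.

(** The same iteration on scalars with [z] replaced by 1; it dominates [visser z] because the
    coefficients are nonnegative. *)
Fixpoint visser_bound n : R :=
  if n is m.+1 then 2^-1 * (1 + visser_bound m ^+ 2) else 0.

Lemma visser_bound_ge0 n : 0 <= visser_bound n.
Proof. by elim: n => //= n IHn; rewrite mulr_ge0 ?addr_ge0 ?exprn_ge0 ?invr_ge0. Qed.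

Lemma visser_bound_le1 n : visser_bound n <= 1.
Proof.
elim: n => [|n IHn] /=; first exact: ler01.
have := visser_bound_ge0 n; nra.
Qed.

Lemma visser_doubling z n : visser z n.+1 + visser z n.+1 = z + visser z n * visser z n.
Proof.
rewrite /= -scalerDl -rmorphD (_ : 2^-1 + 2^-1 = 1 :> R) ?scale1r //; lra.
Qed.

Lemma visser_bnd z n : ubnd 1 z -> ubnd (visser_bound n) (visser z n).
Proof.
move=> bz; elim: n => [|n IHn].
  by move=> a; rewrite /= /uact /= scale0r cmul0l addr0 nrm0 mul0r.
have := ubndM (visser_bound_ge0 n) IHn IHn; rewrite -expr2 => b2.
by have := ubndZ 2^-1 (ubndD bz b2); rewrite ger0_norm.
Qed.

(** Successive differences satisfy [d' = (u' d + d u) / 2], and the scalar iteration obeys the same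
    recursion exactly, so the bound propagates. *)
Lemma visser_step_bnd z n : ubnd 1 z ->
  ubnd (visser_bound n.+1 - visser_bound n) (visser z n.+1 - visser z n).
Proof.
move=> bz; elim: n => [|n IHn].
  by rewrite !subr0; exact: visser_bnd.
have -> : visser z n.+2 - visser z n.+1 = (2^-1 : R)%:C *:
    (visser z n.+1 * (visser z n.+1 - visser z n)
      + (visser z n.+1 - visser z n) * visser z n).
  rewrite [visser z n.+2]/= [X in _ - X]/= -scalerBr; congr (_ *: _).
  by rewrite mulrBr mulrBl -/(visser z n.+1); abel.
set d := visser_bound n.+1 - visser_bound n in IHn.
have d0 : 0 <= d.
  by rewrite /d /=; have := visser_bound_le1 n; have := visser_bound_ge0 n; nra.
have := ubndZ 2^-1 (ubndD (ubndM (visser_bound_ge0 n.+1) (visser_bnd n.+1 bz) IHn)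
   (ubndM d0 IHn (visser_bnd n bz))).
rewrite ger0_norm //; apply: ubnd_le; rewrite /d.
have : visser_bound n.+2 = 2^-1 * (1 + visser_bound n.+1 ^+ 2) by [].
have : visser_bound n.+1 = 2^-1 * (1 + visser_bound n ^+ 2) by [].
move: (visser_bound n.+2) (visser_bound n.+1) => f2 f1; lra.
Qed.

(** The bounds never exceed 1, so by the Archimedean property their increments cannot all be larger
    than [e]. *)
Lemma visser_bound_step_small (e : R) : 0 < e ->
  exists n, visser_bound n.+1 - visser_bound n <= e.
Proof.
move=> e0; apply: contrapT => /forallNP large.
have grow n : n%:R * e <= visser_bound n.
  elim: n => [|n IHn]; first by rewrite mul0r.
  have := large n => /negP; rewrite -ltNge => ?.
  rewrite -natr1 mulrDl mul1r; lra.
set n := Num.bound e^-1.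
have : e^-1 < n%:R by apply: archi_boundP; rewrite invr_ge0 ltW.
rewrite -[e^-1]div1r ltr_pdivrMr //.
have := grow n; have := visser_bound_le1 n; lra.
Qed.

Lemma visser_comm y z n : GRing.comm y z -> GRing.comm y (visser z n).
Proof.
move=> yz; elim: n => [|n IHn] /=; first exact: commr0.
have : GRing.comm y (z + visser z n * visser z n).
  by apply: commrD => //; apply: commrM.
by rewrite /GRing.comm -scalerAl -scalerAr => ->.
Qed.

Lemma visser_star z n : ustar z = z -> ustar (visser z n) = visser z n.
Proof.
move=> zS; elim: n => [|n IHn]; first by congr pair; [exact: conjC0 | exact: cstar0].
by rewrite /= ustarZ conj_Creal ?complex_real // ustarD ustarM zS IHn.
Qed.

(** The root [1 - visser z n] is a polynomial in [z], whence self-adjointness and the commutation;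
    its error is twice an increment of the iteration. *)
Lemma unit_sqrt z (e : R) : 0 < e -> ustar z = z -> ubnd 1 z -> exists s : U,
  [/\ ustar s = s, forall y, GRing.comm y z -> GRing.comm y s &
      ubnd e (s * s - (1 - z))].
Proof.
move=> e0 zS bz; have [|n small] := @visser_bound_step_small (e / 2); first lra.
exists (1 - visser z n); split.
- by rewrite ustarB ustar1 visser_star.
- by move=> y yz; apply: commrB; [exact: commr1|exact: visser_comm].
have -> : (1 - visser z n) * (1 - visser z n) - (1 - z) =
    (visser z n.+1 - visser z n) + (visser z n.+1 - visser z n).
  have -> : visser z n.+1 - visser z n + (visser z n.+1 - visser z n) =
    (visser z n.+1 + visser z n.+1) - (visser z n + visser z n) by abel.
  by rewrite visser_doubling mulrBl !mulrBr !mul1r !mulr1; abel.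
by apply: ubnd_le (ubndD (visser_step_bnd n bz) (visser_step_bnd n bz)); lra.
Qed.

Lemma scale_invK (c : R) x : c != 0 -> c%:C *: (c^-1%:C *: x) = x.
Proof. by move=> c0; rewrite scalerA -rmorphM /= mulfV // scale1r. Qed.

(** The hypothesis on [N] is positivity in terms of norms: a self-adjoint [x] within [N ^+ 2] of the
    scalar [N ^+ 2]. Rescaling reduces to [unit_sqrt]. *)
Lemma approx_sqrt x (N e : R) : 0 < N -> 0 < e -> ustar x = x ->
  ubnd (N ^+ 2) ((N ^+ 2)%:C *: 1 - x) -> exists s : U,
  [/\ ustar s = s, forall y, GRing.comm y x -> GRing.comm y s & ubnd e (s * s - x)].
Proof.
move=> N0 e0 xS bx; have N2 : 0 < N ^+ 2 by rewrite exprn_gt0.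
have N2n0 : N ^+ 2 != 0 by rewrite gt_eqF.
set w := (N ^+ 2)^-1%:C *: x; have wS : ustar w = w.
  by rewrite /w ustarZ conj_Creal ?complex_real ?xS.
have wE : 1 - w = (N ^+ 2)^-1%:C *: ((N ^+ 2)%:C *: 1 - x).
  by rewrite scalerBr scalerA -rmorphM /= mulVf // scale1r.
have bw : ubnd 1 (1 - w).
  rewrite wE; have := ubndZ (N ^+ 2)^-1 bx; rewrite ger0_norm ?mulVf //.
  by rewrite invr_ge0 ltW.
have [|||s [sS s_comm s_small]] := @unit_sqrt (1 - w) (e / N ^+ 2) => //.
- by rewrite divr_gt0.
- by rewrite ustarB ustar1 wS.
exists (N%:C *: s); split.
- by rewrite ustarZ conj_Creal ?complex_real ?sS.
- move=> y yx; have : GRing.comm y s.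
    apply: s_comm; apply: commrB; first exact: commr1.
    by rewrite /GRing.comm /w -scalerAl -scalerAr yx.
  by rewrite /GRing.comm -scalerAl -scalerAr => ->.
have -> : N%:C *: s * (N%:C *: s) - x = (N ^+ 2)%:C *: (s * s - (1 - (1 - w))).
  have -> : s * s - (1 - (1 - w)) = s * s - w by abel.
  rewrite -scalerAl -scalerAr scalerA -rmorphM /= -expr2.
  by rewrite scalerBr /w scale_invK.
have := ubndZ (N ^+ 2) s_small; rewrite ger0_norm ?(ltW N2) //.
by rewrite mulrCA mulfV // mulr1.
Qed.

Lemma iscaleK x : 'i *: ('i *: x) = - x.
Proof. by rewrite scalerA -expr2 sqrCi scaleN1r. Qed.

Lemma cartesian_mul x y : GRing.comm x y ->
  (x - 'i *: y) * (x + 'i *: y) = x * x + y * y.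
Proof.
move=> xy; rewrite mulrBl !mulrDr -!scalerAl -!scalerAr iscaleK xy; abel.
Qed.

Lemma ustar_cartesian x y : ustar x = x -> ustar y = y ->
  ustar (x + 'i *: y) = x - 'i *: y.
Proof. by move=> xS yS; rewrite ustarD ustarZ conjCi scaleNr xS yS. Qed.

(* x + i sqrt (1 - x^2) is unitary. *)
Lemma unit_square_pos x : ustar x = x -> ubnd 1 x -> ubnd 1 (1 - x * x).
Proof.
move=> xS bx; apply: (@ubnd_lim _ _ 4) => e e0 e1.
have [|||s [sS s_comm s_small]] := @unit_sqrt (x * x) e => //.
- by rewrite ustarM xS.
- by rewrite -[1]mulr1; apply: ubndM.
have xs : GRing.comm x s by apply: s_comm; apply: commrM.
set h := s * s - (1 - x * x) in s_small.
have sE : x * x + s * s = 1 + h by rewrite /h; abel.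
have bV : ubnd (1 + e) (x + 'i *: s).
  apply: ubnd_cstar; first lra.
  rewrite ustar_cartesian // cartesian_mul // sE.
  by apply: ubnd_le (ubndD (@ubnd1 _ _) s_small); nra.
have bV' := ubnd_star bV; rewrite ustar_cartesian // in bV'.
(* [s] is the imaginary part of the nearly unitary [x + 'i *: s], and [1 - x * x] is its square up
   to [h]. *)
have bs : ubnd (1 + e) s.
  have : ubnd ((1 + e) + (1 + e)) ('i *: s + 'i *: s).
    have -> : 'i *: s + 'i *: s = (x + 'i *: s) - (x - 'i *: s) by abel.
    exact: ubndB.
  move=> /ubnd_half /ubndi; rewrite iscaleK => /ubndN; rewrite opprK.
  by apply: ubnd_le; lra.
have -> : 1 - x * x = s * s - h by rewrite /h; abel.
have e0' : 0 <= 1 + e by lra.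
by apply: ubnd_le (ubndB (ubndM e0' bs bs) s_small); nra.
Qed.

(** Squares of self-adjoint elements meet the criterion of [approx_sqrt]. Since such bounds add up,
    so do sums of squares, which is how [defect_pos] proceeds. *)
Lemma square_pos x (N : R) : 0 < N -> ustar x = x -> ubnd N x ->
  ubnd (N ^+ 2) ((N ^+ 2)%:C *: 1 - x * x).
Proof.
move=> N0 xS bx; set y := N^-1%:C *: x.
have N_neq0 : N != 0 by rewrite gt_eqF.
have by_ : ubnd 1 y.
  by have := ubndZ N^-1 bx; rewrite ger0_norm ?invr_ge0 ?(ltW N0) // mulVf.
have yS : ustar y = y by rewrite ustarZ conj_Creal ?complex_real ?xS.
have := ubndZ (N ^+ 2) (unit_square_pos yS by_).
rewrite mulr1 ger0_norm ?exprn_ge0 ?(ltW N0) // scalerBr.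
suff -> : (N ^+ 2)%:C *: (y * y) = x * x by [].
by rewrite expr2 rmorphM /= -scalerA scalerAr scalerAl /y !scale_invK.
Qed.

End SquareRoot.

(** * Comparison of projections *)

Section ProjectionOrder.
Variables (R : realType) (A : cstarAlg R).
Local Notation U := (unitization A).
Implicit Types (x y z : U).

Lemma ubnd0_cstar x : ubnd 0 (ustar x * x) -> ubnd 0 x.
Proof. by move=> bxx; apply: ubnd_cstar => //; rewrite expr0n. Qed.

(* Applied below to z = q p q and d = c q, where p - q = c^* c. *)
Section Defect.
Variables d q z : U.
Hypotheses (zS : ustar z = z) (qS : ustar q = q) (qq : q * q = q).
Hypotheses (qz : q * z = z) (zq : z * q = z) (z1 : ubnd 1 z) (q1 : ubnd 1 q).
Hypotheses (dq : d * q = d) (dd : ustar d * d = z - q).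

(** [ustar d * d] is minus the positive element [q - z]. The product [k] in the other order will be
    positive, with a cube close to minus a square; this is what forces [d] to act as zero. [da] and
    [ad] trade a factor [k] next to [d] for [- a]. *)
Let a := 1 - z.
Let k := d * ustar d.

Let qd : q * ustar d = ustar d.
Proof. by rewrite -{1}qS -ustarM dq. Qed.

Let da : d * a = - (k * d).
Proof. by rewrite /a /k -mulrA dd !mulrBr mulr1 dq opprB. Qed.

Let ad : a * ustar d = - (ustar d * k).
Proof. by rewrite /a /k mulrA dd !mulrBl mul1r qd opprB. Qed.

Let kS : ustar k = k.
Proof. by rewrite ustarM ustarK. Qed.

Let d_bnd : ubnd 2 d.
Proof.
apply: ubnd_cstar => //; rewrite dd.
by apply: ubnd_le (ubndB z1 q1); rewrite expr2; lra.
Qed.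

Let k_bnd : ubnd 4 k.
Proof. by apply: ubnd_le (ubndM _ d_bnd (ubnd_star d_bnd)) => //; lra. Qed.

Lemma defect_sqrt (e : R) : 0 < e -> e <= 1 -> exists s, [/\ ustar s = s,
  GRing.comm q s, GRing.comm a s, ubnd e (s * s - a) & ubnd 2 s].
Proof.
move=> e0 e1; have [s [sS s_comm s_small]] := unit_sqrt e0 zS z1.
exists s; split => //.
- by apply: s_comm; rewrite /GRing.comm qz zq.
- by apply: s_comm; apply/commr_sym/commrB; [exact: commr1|].
- apply: ubnd_cstar => //; rewrite sS.
  have -> : s * s = (s * s - a) + (1 - z) by rewrite /a; abel.
  by apply: ubnd_le (ubndD s_small (ubndB (@ubnd1 _ _) z1)); rewrite expr2; lra.
Qed.

(* 4 k = 2 x^2 + 2 y^2 + 4 (q - z) with d + d^* = x and 'i (d - d^* ) = y, and q - z is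
   close to the square of s q, where s is an approximate square root of 1 - z. *)
Lemma defect_pos : ubnd (10 ^+ 2) ((10 ^+ 2 : R)%:C *: 1 - (k + k + (k + k))).
Proof.
apply: (@ubnd_lim _ _ 4) => e e0 e1.
have [s [sS qs _ s_small s_bnd]] := defect_sqrt e0 e1.
set x := d + ustar d; set y := 'i *: (d - ustar d); set t := s * q.
have xS : ustar x = x by rewrite /x ustarD ustarK addrC.
have yS : ustar y = y.
  by rewrite /y ustarZ conjCi ustarB ustarK scaleNr -scalerN opprB.
have tS : ustar t = t by rewrite /t ustarM sS qS.
have dS_bnd := ubnd_star d_bnd.
have x_bnd : ubnd 4 x by apply: ubnd_le (ubndD d_bnd dS_bnd); lra.
have y_bnd : ubnd 4 y by apply: ubndi; apply: ubnd_le (ubndB d_bnd dS_bnd); lra.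
have t_bnd : ubnd 2 t by apply: ubnd_le (ubndM _ s_bnd q1) => //; lra.
have xyE : x * x + y * y = k + k + (z - q) + (z - q).
  rewrite /y -scalerAl -scalerAr iscaleK /x !mulrDl !mulrDr !mulNr !mulrN.
  by rewrite -/k dd; abel.
set h := s * s - a.
have tE : t * t = q - z + h * q.
  have -> : t * t = s * s * q by rewrite /t -mulrA [q * (_ * _)]mulrA qs -mulrA qq mulrA.
  have -> : s * s = h + (1 - z) by rewrite /h /a; abel.
  by rewrite mulrDl [(1 - z) * q]mulrBl mul1r zq; abel.
have lt04 : 0 < 4 :> R by lra.
have pxy := ubndD (square_pos lt04 xS x_bnd) (square_pos lt04 yS y_bnd).
have lt02 : 0 < 2 :> R by lra.
have pt := square_pos lt02 tS t_bnd.
have pxy2 := ubndD pxy pxy; have pt2 := ubndD pt pt; have pt4 := ubndD pt2 pt2.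
(* The squares account for [2 (16 + 16) + 4 * 4 = 80]; adding 20 completes this to [10 ^+ 2], a
   square as [approx_sqrt] requires. *)
have b1 : ubnd 20 ((20 : R)%:C *: (1 : U)).
  by have := ubndZ 20 (@ubnd1 _ A); rewrite ger0_norm // mulr1.
have bh : ubnd e (h * q).
  by apply: ubnd_le (ubndM _ s_small q1); rewrite ?mulr1 // ltW.
have bh2 := ubndD bh bh; have bh4 := ubndD bh2 bh2.
have := ubndD (ubndD (ubndD pxy2 pt4) b1) bh4.
have -> : (4 ^+ 2 : R)%:C *: 1 - x * x + ((4 ^+ 2 : R)%:C *: 1 - y * y) =
   (32 : R)%:C *: 1 - (x * x + y * y).
  have -> : (32 : R)%:C *: (1 : U) = (4 ^+ 2 : R)%:C *: 1 + (4 ^+ 2 : R)%:C *: 1.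
    by rewrite -scale_realD; congr (_%:C *: _); rewrite !expr2; lra.
  by abel.
set c32 := (32 : R)%:C *: (1 : U); set c4 := (2 ^+ 2 : R)%:C *: (1 : U).
set c20 := (20 : R)%:C *: (1 : U).
have -> : (10 ^+ 2 : R)%:C *: (1 : U) = c32 + c32 + (c4 + c4 + (c4 + c4)) + c20.
  by rewrite /c32 /c4 /c20 -!scale_realD; congr (_%:C *: _); rewrite !expr2; lra.
rewrite xyE tE.
have -> : c32 - (k + k + (z - q) + (z - q)) + (c32 - (k + k + (z - q) + (z - q))) +
     (c4 - (q - z + h * q) + (c4 - (q - z + h * q)) +
      (c4 - (q - z + h * q) + (c4 - (q - z + h * q)))) + c20 +
     (h * q + h * q + (h * q + h * q)) =
   c32 + c32 + (c4 + c4 + (c4 + c4)) + c20 - (k + k + (k + k)) by abel.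
by apply: ubnd_le; rewrite !expr2; lra.
Qed.

(* With r^2 close to 4 k and f = d s d^* one has f^2 close to - k^3, and k r commutes
   with f, so k r + 2 i f, whose absolute value squared is (k r)^2 + 4 f^2, is small. *)
Lemma defect_eq0 : ubnd 0 d.
Proof.
(* From [k^3] descend by the C*-inequality: [k^4] is the square of [k^2], [k^2] that of [k], and [k]
   is [d * ustar d]. *)
suff k3 : ubnd 0 (k * k * k).
  have k4 : ubnd 0 (ustar (k * k) * (k * k)).
    rewrite ustarM kS mulrA -[0](@mul0r R 4).
    exact: ubndM k3 k_bnd.
  have k2 : ubnd 0 (ustar k * k) by rewrite kS; apply: ubnd0_cstar.
  have {k2} /ubnd0_cstar : ubnd 0 (ustar (ustar d) * ustar d).
    by rewrite ustarK; apply: ubnd0_cstar.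
  by move=> /ubnd_star; rewrite ustarK.
suff k34 : ubnd 0 (k * k * k + k * k * k + (k * k * k + k * k * k)).
  by have := ubnd_half (ubnd_half k34); rewrite !mul0r.
(* Roots are taken to accuracy [e ^+ 2]. The square of [w] is then at most
   [16 e^2 + 4 * 8 e^2 <= (7 e)^2], and [65 = 49 + 16] collects [x * x] and [k * k * g]. *)
apply: (@ubnd_lim _ _ 65) => e e0 e1; rewrite add0r.
have ee0 : 0 < e ^+ 2 by rewrite exprn_gt0.
have ee1 : e ^+ 2 <= 1 by rewrite exprn_ile1 // ltW.
have ee : e ^+ 2 <= e by rewrite expr2 ler_piMl // ltW.
have k4S : ustar (k + k + (k + k)) = k + k + (k + k) by rewrite !ustarD kS.
have [|r [rS r_comm r_small]] := approx_sqrt _ ee0 k4S defect_pos; first lra.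
have [s [sS qs as_ s_small s_bnd]] := defect_sqrt ee0 ee1.
set f := d * s * ustar d.
have fS : ustar f = f by rewrite /f !ustarM ustarK sS mulrA.
have dkd : ustar d * k = - (a * ustar d) by rewrite ad opprK.
have kdE : k * d = - (d * a) by rewrite da opprK.
(* Moving [k] past [ustar d] or [d] turns it into [- a], which commutes with [s]. *)
have fk : GRing.comm f k.
  rewrite /GRing.comm {1}/f -mulrA dkd /f !mulrA kdE !mulNr !mulrN.
  by rewrite -!mulrA [a * (s * _)]mulrA as_ -mulrA.
have sd : (z - q) * (s * ustar d) = - (a * (s * ustar d)).
  by rewrite /a !mulrBl mul1r [q * (s * _)]mulrA qs -mulrA qd; abel.
have a_bnd : ubnd 2 a by apply: ubnd_le (ubndB (@ubnd1 _ _) z1); lra.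
set h := s * s - a in s_small.
have ssE : s * s = a + h by rewrite /h; abel.
clearbody h; clearbody a.
have ffE : f * f = - (k * k * k) - d * a * h * ustar d.
  have -> : f * f = d * s * ((z - q) * (s * ustar d)) by rewrite -dd /f !mulrA.
  rewrite sd mulrN -[d * s * _]mulrA [s * (a * _)]mulrA -as_ -[a * s * _]mulrA [s * (s * _)]mulrA.
  have kkk : d * (a * (a * ustar d)) = k * k * k.
    by rewrite ad !mulrN mulrA da mulNr opprK -!mulrA.
  by rewrite ssE mulrDl !mulrDr kkk !mulrA; abel.
have kr : GRing.comm k r by apply: r_comm; do 2!apply: commrD => //.
have fr : GRing.comm f r by apply: r_comm; do 2!apply: commrD => //.
set x := k * r; set y := f + f; set w := x + 'i *: y.
have xS : ustar x = x by rewrite /x ustarM kS rS kr.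
have yS : ustar y = y by rewrite /y ustarD fS.
have xy : GRing.comm x y.
  by apply/commr_sym/commrM; apply/commr_sym/commrD; apply: commr_sym.
set g := r * r - (k + k + (k + k)) in r_small.
have xxE : x * x = k * k * k + k * k * k + (k * k * k + k * k * k) + k * k * g.
  have -> : x * x = k * k * (r * r) by rewrite /x -mulrA [r * (_ * _)]mulrA -kr !mulrA.
  have -> : r * r = k + k + (k + k) + g by rewrite /g; abel.
  by rewrite !mulrDr.
have kk_bnd : ubnd 16 (k * k) by apply: ubnd_le (ubndM _ k_bnd k_bnd) => //; lra.
have kkg_bnd : ubnd (16 * e ^+ 2) (k * k * g) by apply: ubndM.
have da_bnd : ubnd 4 (d * a) by apply: ubnd_le (ubndM _ d_bnd a_bnd) => //; lra.
have dah_bnd : ubnd (8 * e ^+ 2) (d * a * h * ustar d).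
  have le04 : 0 <= 4 :> R by lra.
  by apply: ubnd_le (ubndM _ (ubndM le04 da_bnd s_small) (ubnd_star d_bnd)); nra.
have w_bnd : ubnd (7 * e) w.
  apply: ubnd_cstar; first by rewrite mulr_ge0 // ltW.
  rewrite ustar_cartesian // cartesian_mul // xxE.
  set m := d * a * h * ustar d in dah_bnd ffE.
  have -> : k * k * k + k * k * k + (k * k * k + k * k * k) + k * k * g + y * y =
      k * k * g - (m + m + (m + m)).
    by rewrite /y mulrDl !mulrDr ffE; abel.
  have m2 := ubndD dah_bnd dah_bnd.
  by apply: ubnd_le (ubndB kkg_bnd (ubndD m2 m2)); nra.
have x_bnd : ubnd (7 * e) x.
  have := ubndD w_bnd (ubnd_star w_bnd); rewrite ustar_cartesian //.
  have -> : w + (x - 'i *: y) = x + x by rewrite /w; abel.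
  by move=> /ubnd_half; apply: ubnd_le; lra.
have -> : k * k * k + k * k * k + (k * k * k + k * k * k) = x * x - k * k * g.
  by rewrite xxE; abel.
have e7 : 0 <= 7 * e by lra.
by apply: ubnd_le (ubndB (ubndM e7 x_bnd x_bnd) kkg_bnd); nra.
Qed.

End Defect.

(** Once [c ** q = 0], one has [q ** p ** q = q], and then [q - q ** p] times its adjoint is
    [q - q ** p ** q = 0]. *)
Lemma projection_le (p q c : A) : is_projection p -> is_projection q ->
  p - q = c^# ** c -> q ** p = q.
Proof.
move=> pP qP pqc; have [[pS pp] [qS qq]] := (pP, qP).
have qpq_bnd : ubnd 1 (uin (q ** p ** q)).
  apply: ubnd_le (ubnd_uin _); have := nrmM (q ** p) q; have := nrmM q p.
  have := projection_nrm_le1 pP; have := projection_nrm_le1 qP.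
  have := nrm_ge0 p; have := nrm_ge0 q; have := nrm_ge0 (q ** p); nra.
have q_bnd : ubnd 1 (uin q) by apply: ubnd_le (ubnd_uin _); apply: projection_nrm_le1.
have ddE : (c ** q)^# ** (c ** q) = q ** p ** q - q.
  rewrite cstarM -cmulA [c^# ** _]cmulA -pqc cmulBl cmulBr qS !cmulA.
  by rewrite -[q ** q ** q]cmulA !qq.
have : ubnd 0 (uin (c ** q)).
  apply: (@defect_eq0 _ (uin q) (uin (q ** p ** q))) => //.
  - by rewrite uin_star !cstarM qS pS cmulA.
  - by rewrite uin_star qS.
  - by rewrite -uinM qq.
  - by rewrite -uinM !cmulA qq.
  - by rewrite -uinM -!cmulA qq.
  - by rewrite -uinM -cmulA qq.
  - by rewrite uin_star -uinM ddE uinB.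
move=> /uin_bnd0 cq0; rewrite cq0 cmul0r in ddE.
have qpq : q ** p ** q = q by apply/eqP; rewrite -subr_eq0 -ddE.
apply/esym/subr0_eq; rewrite -[q - _]cstarK (@star_mul_eq0 _ _ (q - q ** p)^#) ?cstar0 //.
rewrite cstarK cstarB cstarM qS pS cmulBl !cmulBr qq !cmulA qpq.
by rewrite -[q ** p ** p]cmulA pp qpq; abel.
Qed.

End ProjectionOrder.

(** Serves [lsum_iso]: weights enter twice, once from each factor of the square. The partial sums of
    the scalars are increasing and bounded, and the term of [i0] makes the limit positive. *)
Lemma csum_wgt_const (R : realType) (A : cstarAlg R) (I : countType) (F : pred I)
    (a : A) (i0 : I) : F i0 -> exists2 c : R, 0 < c &
  csum (fun i => if F i then (wgt i)%:C *: a else 0) = c%:C *: a.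
Proof.
move=> Fi0; pose t m : R :=
  oapp (fun i => if F i then kap ^+ m.+1 * wgt i else 0) 0 (pickle_inv m : option I).
pose cs n := \sum_(m < n) t m.
have t_ge0 m : 0 <= t m.
  rewrite /t; case: pickle_inv => //= i; case: ifP => // _.
  by rewrite mulr_ge0 ?kapX_ge0.
have cs_step n : cs n.+1 = cs n + t n by rewrite /cs big_ord_recr.
have cs_homo : {homo cs : m n / (m <= n)%N >-> m <= n}.
  by apply: homo_leq => // [x y z|n]; [exact: le_trans|rewrite cs_step lerDl].
have t_le m : t m <= kap ^+ m.+1.
  rewrite /t; case: pickle_inv => [i|] /=; last exact: kapX_ge0.
  case: ifP => _; last exact: kapX_ge0.
  by rewrite ler_piMr ?kapX_ge0 // (le_trans (wgt_le R i)) ?kap_le1.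
have cs_le n : cs n <= 2 * (kap - kap ^+ n.+1).
  elim: n => [|n IHn]; first by rewrite /cs big_ord0 expr1 subrr mulr0.
  rewrite cs_step; have := t_le n; have := kapX_gt0 R n.+1.
  rewrite [kap ^+ n.+2]exprS; move: (kap ^+ n.+1) IHn => k; rewrite /kap; lra.
have cs_cvg : cs @ \oo --> limn cs.
  apply: nondecreasing_is_cvgn; first by move=> m n; exact: cs_homo.
  exists (2 * kap) => _ [n _ <-]; apply: le_trans (cs_le n) _.
  by have := kapX_ge0 R n.+1; lra.
exists (limn cs).
  apply: (@lt_le_trans _ _ (cs (pickle i0).+1)).
    have := cs_homo 0%N (pickle i0) isT; rewrite [cs 0%N]/cs big_ord0 cs_step => ge0.
    by rewrite ltr_wpDl // /t pickleK_inv /= Fi0 mulr_gt0 ?kapX_gt0 ?wgt_gt0.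
  apply: nondecreasing_cvgn_le; first by move=> m n; exact: cs_homo.
  by apply/cvg_ex; exists (limn cs).
apply: csum_unique.
  exists (nrm a) => i; case: ifP => _; last by rewrite nrm0 nrm_ge0.
  rewrite nrmZ ger0_norm ?ler_piMl ?nrm_ge0 //; last exact/ltW/wgt_gt0.
  by rewrite (le_trans (wgt_le R i)) ?kap_le1.
have psumE n : psum (fun i => if F i then (wgt i)%:C *: a else 0) n = (cs n)%:C *: a.
  elim: n => [|n IHn]; first by rewrite /psum /cs !big_ord0 scale0r.
  rewrite cs_step scale_realD -IHn /psum big_ord_recr; congr (_ + _).
  rewrite /wterm /t; case: pickle_inv => [i|] /=; last by rewrite scale0r.
  by case: ifP => _; rewrite ?scalerA -?rmorphM // scaler0 scale0r.
move=> e e0; have e'0 : 0 < e / (nrm a + 1).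
  by rewrite divr_gt0 // ltr_wpDl ?nrm_ge0.
have /cvgrPdist_le /(_ _ e'0) [N _ csN] := cs_cvg.
exists N => n /csN; rewrite psumE -scalerBl -rmorphB /= nrmZ distrC => small.
have a0 := nrm_ge0 a; move: small; rewrite ler_pdivlMr; last lra.
have := normr_ge0 (cs n - limn cs); nra.
Qed.

(** * The generator *)

Section CuntzKrieger.
Variables (R : realType) (E : digraph) (A : cstarAlg R).
Variables (p : vertex E -> A) (s : edge E -> A).
Hypothesis ck : cuntz_krieger_family p s.
Implicit Types (v w : vertex E) (e f g : edge E).

Definition rproj e : A := s e ** (s e)^#.

Let pS v : (p v)^# = p v. Proof. by have [] := ck_proj ck v. Qed.
Let pp v : p v ** p v = p v. Proof. by have [] := ck_proj ck v. Qed.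
Let pw v w : v != w -> p v ** p w = 0.
Proof. by move=> /eqP; apply: ck_proj_orth ck _ _. Qed.

Let ss e : (s e)^# ** s e = p (src e). Proof. exact: ck_source ck e. Qed.

Let s_src e : s e ** p (src e) = s e.
Proof.
apply/subr0_eq/star_mul_eq0; rewrite cstarB cstarM pS cmulBl !cmulBr -!cmulA.
by rewrite [(s e)^# ** (s e ** _)]cmulA ss !pp; abel.
Qed.

Let src_star e : p (src e) ** (s e)^# = (s e)^#.
Proof. by rewrite -{1}pS -cstarM s_src. Qed.

Let rS e : (rproj e)^# = rproj e.
Proof. by rewrite cstarM cstarK. Qed.

Let r_s e : rproj e ** s e = s e.
Proof. by rewrite /rproj -cmulA ss s_src. Qed.

Let rr e : rproj e ** rproj e = rproj e.
Proof. by rewrite {2}/rproj cmulA r_s. Qed.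

Let star_r e : (s e)^# ** rproj e = (s e)^#.
Proof. by rewrite -rS -cstarM r_s. Qed.

Lemma rproj_projection e : is_projection (rproj e).
Proof. by split; [exact: rS|exact: rr]. Qed.

Let r_orth e f : e != f -> rproj e ** rproj f = 0.
Proof. by move=> /eqP; apply: ck_ranges_orth ck _ _. Qed.

Let star_s e f : e != f -> (s e)^# ** s f = 0.
Proof.
by move=> ef; rewrite -star_r -[s f]r_s -cmulA [rproj e ** _]cmulA r_orth // cmul0l cmul0r.
Qed.

(** The only appeal to [projection_le]; the identities relating an edge to its range vertex follow
    from it. *)
Let r_rng e : rproj e ** p (rng e) = rproj e.
Proof.
have [c pr] := ck_range ck e.
exact: (projection_le (ck_proj ck _) (rproj_projection e) pr).
Qed.

Let rng_r e : p (rng e) ** rproj e = rproj e.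
Proof. by rewrite -{1}pS -{1}rS -cstarM r_rng rS. Qed.

Let rng_s e : p (rng e) ** s e = s e.
Proof. by rewrite -{1}r_s cmulA rng_r r_s. Qed.

Let star_rng e : (s e)^# ** p (rng e) = (s e)^#.
Proof. by rewrite -{1}pS -cstarM rng_s. Qed.

Let p_s v e : v != rng e -> p v ** s e = 0.
Proof. by move=> ve; rewrite -rng_s cmulA pw // cmul0l. Qed.

Let s_p e v : v != src e -> s e ** p v = 0.
Proof. by move=> ve; rewrite -s_src -cmulA pw 1?eq_sym // cmul0r. Qed.

Let star_p e v : v != rng e -> (s e)^# ** p v = 0.
Proof. by move=> ve; rewrite -star_rng -cmulA pw 1?eq_sym // cmul0r. Qed.

Let p_star v e : v != src e -> p v ** (s e)^# = 0.
Proof. by move=> ve; rewrite -src_star cmulA pw // cmul0l. Qed.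

Let r_s0 e f : e != f -> rproj e ** s f = 0.
Proof. by move=> ef; rewrite /rproj -cmulA star_s // cmul0r. Qed.

Let p1 v : nrm (p v) <= 1. Proof. exact: projection_nrm_le1 (ck_proj ck v). Qed.
Let s1 e : nrm (s e) <= 1. Proof. exact: pisom_nrm_le1 (ck_pisom ck e). Qed.
Let r1 e : nrm (rproj e) <= 1.
Proof. exact: projection_nrm_le1 (rproj_projection e). Qed.

(** * Orientation of the edges; loops and closed paths of length two *)

Definition reverses e f := src f = rng e /\ rng f = src e.

(** The codes of the vertices provide the linear order that decides which of two directions is
    wrong. *)
Definition back e := (src e != rng e) && (pickle (src e) < pickle (rng e))%N
  && `[< exists f, reverses e f >].

(** The default [e] is taken only if no edge reverses [e], hence never for a [back] edge. *)
Definition ret e := xget e [set f | reverses e f].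

Definition looplike e := (src e == rng e) || back e.

Lemma ret_reverses e : back e -> reverses e (ret e).
Proof.
move=> /andP[_ /asboolP[f ef]]; rewrite /ret; case: xgetP => [g -> //|/(_ f)].
by case.
Qed.

(** Of two opposite non-loops the one with the smaller source code is [back]; if neither is, the
    codes agree and [e] is a loop. *)
Lemma direct_no_2cycle e f :
  ~~ looplike e -> ~~ looplike f -> reverses e f -> False.
Proof.
rewrite /looplike !negb_or /back => /andP[ne_e Ne] /andP[ne_f Nf] [f_src f_rng].
move: Ne Nf; rewrite ne_e ne_f f_src f_rng /=.
have -> : `[< exists f, reverses e f >] by apply/asboolP; exists f.
have -> : `[< exists g, reverses f g >] by apply/asboolP; exists e; rewrite /reverses f_src f_rng.
rewrite !andbT -!leqNgt => le1 le2.
by move: ne_e; rewrite (pcan_inj pickleK (anti_leq (introT andP (conj le2 le1)))) eqxx.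
Qed.

Lemma ret_direct e : back e -> ~~ looplike (ret e).
Proof.
move=> e_back; have [ret_src ret_rng] := ret_reverses e_back.
move: e_back => /andP[/andP[ne lt_e] _].
rewrite /looplike /back ret_src ret_rng negb_or eq_sym ne /=.
by rewrite ltnNge (ltnW lt_e).
Qed.

Lemma loop_not_back e : back e -> (src e == rng e) = false.
Proof. by move=> /andP[/andP[/negPf]]. Qed.

Definition ell e : A := if src e == rng e then s e else s (ret e) ** s e.

Lemma ell_loop e : src e = rng e -> ell e = s e.
Proof. by move=> ee; rewrite /ell ee eqxx. Qed.

Lemma ell_back e : back e -> ell e = s (ret e) ** s e.
Proof. by move=> e_back; rewrite /ell loop_not_back. Qed.

Lemma ret_star_ret e : back e -> (s (ret e))^# ** ell e = s e.
Proof.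
move=> e_back; have [ret_src _] := ret_reverses e_back.
by rewrite ell_back // cmulA ss ret_src rng_s.
Qed.

Lemma ell_iso e : looplike e -> (ell e)^# ** ell e = p (src e).
Proof.
move=> /orP[/eqP ee|e_back]; first by rewrite ell_loop // ss.
by rewrite {1}ell_back // cstarM -cmulA ret_star_ret // ss.
Qed.

Lemma loop_ret e f : src e = rng e -> back f -> e != ret f.
Proof.
move=> ee /ret_direct; apply: contraNneq => <-.
by rewrite /looplike ee eqxx.
Qed.

(** A loop never is a return edge, as these are direct. Two closed paths may share their return
    edge; it then cancels and the orthogonality of [s e] and [s f] remains. *)
Lemma ell_orth e f : looplike e -> looplike f -> e != f -> (ell e)^# ** ell f = 0.
Proof.
move=> /orP[/eqP ee|e_back] /orP[/eqP ff|f_back] ef.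
- by rewrite !ell_loop // star_s.
- by rewrite ell_loop // ell_back // cmulA star_s ?cmul0l // loop_ret.
- by rewrite [ell f]ell_loop // ell_back // cstarM -cmulA star_s ?cmul0r // eq_sym loop_ret.
rewrite !ell_back // cstarM -cmulA [(s (ret e))^# ** _]cmulA.
have [eq_ret|ne_ret] := eqVneq (ret e) (ret f); last by rewrite star_s // cmul0l cmul0r.
have [ret_src _] := ret_reverses f_back.
by rewrite eq_ret ss ret_src rng_s star_s.
Qed.

Lemma p_ell e : looplike e -> p (src e) ** ell e = ell e.
Proof.
move=> /orP[/eqP ee|e_back]; first by rewrite ell_loop // ee rng_s.
have [_ ret_rng] := ret_reverses e_back.
by rewrite ell_back // cmulA -ret_rng rng_s.
Qed.

Lemma ell_nrm e : looplike e -> nrm (ell e) <= 1.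
Proof.
by move=> e_loop; apply: pisom_nrm_le1; rewrite /is_partial_isometry ell_iso.
Qed.

(** * The building blocks of the generator at each vertex *)

Definition lterm v e : A := if (src e == v) && looplike e then ell e else 0.

Lemma lterm_nrm v e : nrm (lterm v e) <= 1.
Proof. by rewrite /lterm; case: ifP => [/andP[_ /ell_nrm //]|]; rewrite nrm0. Qed.

Lemma lterm_bounded v : nbounded (lterm v).
Proof. by exists 1; exact: lterm_nrm. Qed.

Definition lsum v : A :=
  if `[< exists e, src e = v /\ looplike e >] then csum (lterm v) else p v.

(** Orthogonality removes the cross terms, and each remaining one is a positive multiple of [p v] by
    [ell_iso]. *)
Lemma lsum_iso v : exists2 c : R, 0 < c & (lsum v)^# ** lsum v = c%:C *: p v.
Proof.
rewrite /lsum; case: asboolP => [[e0 [e0v e0_loop]]|_]; last first.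
  by exists 1; rewrite ?ltr01 // pS pp scale1r.
have bl := lterm_bounded v.
have [|c c0 cE] := @csum_wgt_const _ A _
    (fun e => (src e == v) && looplike e) (p v) e0.
  by rewrite e0v eqxx.
exists c => //; rewrite -cE csumMl //; congr csum; apply/funext => e.
rewrite /lterm; case: ifP => [/andP[/eqP ev e_loop]|]; last by rewrite cmul0r.
have bl' : nbounded (fun f => (lterm v f)^#).
  by exists 1 => f; rewrite nrm_star lterm_nrm.
rewrite csumS // csumMr // (csum1 (i := e)) /lterm ?ev ?eqxx ?e_loop /=.
  by rewrite ell_iso // ev.
move=> f fe; case: ifP => [/andP[_ f_loop]|]; first by rewrite ell_orth.
by rewrite cstar0 cmul0l.
Qed.

Lemma p_lsum v : p v ** lsum v = lsum v.
Proof.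
rewrite /lsum; case: asboolP => _; last by rewrite pp.
rewrite csumMl; last exact: lterm_bounded.
congr csum; apply/funext => e; rewrite /lterm.
by case: ifP => [/andP[/eqP <- e_loop]|]; rewrite ?p_ell ?cmul0r.
Qed.

Lemma lsum_nrm v : nrm (lsum v) <= 1.
Proof.
rewrite /lsum; case: ifP => _ //; apply: csum_bound0 => //; exact: lterm_nrm.
Qed.

Definition qterm v e : A := if rng e == v then rproj e else 0.

Lemma qterm_nrm v e : nrm (qterm v e) <= 1.
Proof. by rewrite /qterm; case: ifP; rewrite ?nrm0. Qed.

Lemma qterm_bounded v : nbounded (qterm v).
Proof. by exists 1; exact: qterm_nrm. Qed.

Definition qsum v : A := csum (qterm v).

Definition dsum v : A := p v + qsum v.

Lemma p_qsum v : p v ** qsum v = qsum v.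
Proof.
rewrite /qsum csumMl; last exact: qterm_bounded.
congr csum; apply/funext => e; rewrite /qterm.
by case: ifP => [/eqP <-|]; rewrite ?rng_r ?cmul0r.
Qed.

Lemma qsum_star v : (qsum v)^# = qsum v.
Proof.
rewrite /qsum csumS; last exact: qterm_bounded.
by congr csum; apply/funext => e; rewrite /qterm; case: ifP; rewrite ?rS ?cstar0.
Qed.

Lemma qsum_p v : qsum v ** p v = qsum v.
Proof. by rewrite -[LHS]cstarK cstarM pS qsum_star p_qsum qsum_star. Qed.

Lemma qsum_qterm v e : qsum v ** qterm v e = (wgt e)%:C *: qterm v e.
Proof.
rewrite /qsum csumMr; last exact: qterm_bounded.
rewrite (csum1 (i := e)); last first.
  move=> f fe; rewrite /qterm; case: ifP; case: ifP; rewrite ?cmul0l ?cmul0r //.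
  by rewrite r_orth.
by congr (_ *: _); rewrite /qterm; case: ifP; rewrite ?rr ?cmul0l.
Qed.

Lemma dsum_star v : (dsum v)^# = dsum v.
Proof. by rewrite /dsum cstarD pS qsum_star. Qed.

Lemma p_dsum v : p v ** dsum v = dsum v.
Proof. by rewrite /dsum cmulDr pp p_qsum. Qed.

Lemma dsum_p v : dsum v ** p v = dsum v.
Proof. by rewrite /dsum cmulDl pp qsum_p. Qed.

Lemma dsum_nrm v : nrm (dsum v) <= 2.
Proof.
have := nrmD (p v) (qsum v); have := p1 v.
have := csum_bound0 (@qterm_nrm v) ler01; rewrite -/(qsum v) /dsum; lra.
Qed.

(** Half of [2 sum w q + sum w^2 q], arranged as [extract_projections] expects, with perturbations
    [w q / 2]. *)
Lemma dsum_sqr v : (2^-1 : R)%:C *: (dsum v ** dsum v - p v) =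
  csum (fun e => qterm v e + (wgt e / 2)%:C *: qterm v e).
Proof.
have bq := qterm_bounded v.
have bw : nbounded (fun e => (wgt e / 2)%:C *: qterm v e).
  exists 1 => e; rewrite nrmZ -[leRHS]mul1r ler_pM ?nrm_ge0 ?qterm_nrm //.
  have := wgt_gt0 R e; have := wgt_le R e; have := kap_le1 R => k1 k2 k3.
  rewrite ger0_norm; lra.
rewrite csumD // -/(qsum v).
have -> : csum (fun e => (wgt e / 2)%:C *: qterm v e) =
    (2^-1 : R)%:C *: (qsum v ** qsum v).
  rewrite {2}/qsum csumMl // csumZ; last first.
    exists (nrm (qsum v)) => e; apply: le_trans (nrmM _ _) _.
    by rewrite ler_piMr ?nrm_ge0 ?qterm_nrm.
  congr csum; apply/funext => e; rewrite qsum_qterm scalerA -rmorphM.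
  by rewrite [_ / 2]mulrC.
have -> : dsum v ** dsum v - p v = qsum v + qsum v + qsum v ** qsum v.
  by rewrite /dsum cmulDl !cmulDr pp p_qsum qsum_p; abel.
rewrite !scalerDr -scale_realD (_ : 2^-1 + 2^-1 = 1 :> R) ?scale1r //; lra.
Qed.

Definition yterm v : A := lsum v ** dsum v.

Lemma p_yterm v : p v ** yterm v = yterm v.
Proof. by rewrite /yterm cmulA p_lsum. Qed.

Lemma yterm_p v : yterm v ** p v = yterm v.
Proof. by rewrite /yterm -cmulA dsum_p. Qed.

Lemma yterm_nrm v : nrm (yterm v) <= 2.
Proof.
apply: le_trans (nrmM _ _) _; have := lsum_nrm v; have := dsum_nrm v.
have := nrm_ge0 (lsum v); have := nrm_ge0 (dsum v); nra.
Qed.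

Lemma yterm_sqr v : exists2 c : R, 0 < c &
  (yterm v)^# ** yterm v = c%:C *: (dsum v ** dsum v).
Proof.
have [c c0 cE] := lsum_iso v; exists c => //.
rewrite /yterm cstarM -cmulA [(lsum v)^# ** _]cmulA cE cmulZl p_dsum cmulZr.
by rewrite dsum_star.
Qed.

Definition zterm e : A := if looplike e then 0 else s e.

Lemma zterm_nrm e : nrm (zterm e) <= 1.
Proof. by rewrite /zterm; case: ifP => _; rewrite ?nrm0 ?s1. Qed.

Lemma zterm_bounded : nbounded zterm.
Proof. by exists 1; exact: zterm_nrm. Qed.

Definition zsum : A := csum zterm.

(** The half is doubled on adding the adjoint. As [yterm v] has norm at most 2, the factor [kap / 4]
    keeps the perturbation of [p v] in that sum within [kap = 1/100]. *)
Definition vterm v : A := (2^-1 : R)%:C *: p v + (kap / 4 : R)%:C *: yterm v.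

Lemma vterm_bounded : nbounded vterm.
Proof.
exists 1 => v; apply: le_trans (nrmD _ _) _; rewrite !nrmZ.
rewrite !ger0_norm ?invr_ge0 ?divr_ge0 ?kap_ge0 //.
have := yterm_nrm v; have := p1 v; have := kap_le1 R; have := kap_ge0 R.
have := nrm_ge0 (yterm v); nra.
Qed.

Definition single_generator : A := csum vterm + (zsum - zsum^#).

(** * A C*-subalgebra with the generator contains the whole family *)

Section Membership.
Variable S : set A.
Hypotheses (subS : cstar_subalgebra S) (Sx : S single_generator).

Lemma p_mem v : S (p v).
Proof.
have bv := vterm_bounded.
pose c : R := kap / 4.
pose r w : A := c%:C *: (yterm w + (yterm w)^#).
have bvS : nbounded (fun w => (vterm w)^#).
  by have [M vM] := bv; exists M => w; rewrite nrm_star.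
apply: (extract_projections subS (r := r)).
- exact: (ck_proj ck).
- exact: pw.
- move=> w; rewrite /r cmulZr cmulDr p_yterm.
  by have := yterm_p w => /(congr1 (@cstar _ _)); rewrite cstarM pS => ->.
- move=> w; rewrite /r cmulZl cmulDl yterm_p.
  by have := p_yterm w => /(congr1 (@cstar _ _)); rewrite cstarM pS => ->.
- move=> w; rewrite /r nrmZ /c ger0_norm; last by rewrite divr_ge0 ?kap_ge0.
  have := nrmD (yterm w) (yterm w)^#; rewrite nrm_star; have := yterm_nrm w.
  by rewrite /kap; lra.
have -> : csum (fun w => p w + r w) = single_generator + single_generator^#.
  rewrite /single_generator cstarD cstarB cstarK csumS //.
  rewrite (_ : forall a b d e : A, a + (b - d) + (e + (d - b)) = a + e); last first.
    by move=> a b d e; abel.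
  rewrite -csumD //; congr csum; apply/funext => w.
  rewrite /vterm cstarD !cstarZr pS /r scalerDr.
  rewrite (_ : forall a b d e : A, a + b + (d + e) = (a + d) + (b + e)); last first.
    by move=> a b d e; abel.
  by rewrite -scale_realD (_ : 2^-1 + 2^-1 = 1 :> R) ?scale1r //; lra.
by apply: cstar_subD => //; apply: cstar_subS.
Qed.

Lemma p_csum_vterm v : p v ** csum vterm = (wgt v)%:C *: vterm v.
Proof.
have vE w : p v ** vterm w = if w == v then vterm w else 0.
  rewrite /vterm cmulDr !cmulZr; case: eqVneq => [->|wv]; first by rewrite pp p_yterm.
  by rewrite -p_yterm cmulA pw 1?eq_sym // cmul0l !scaler0 addr0.
rewrite csumMl; last exact: vterm_bounded.
by rewrite (csum1 (i := v)) ?vE ?eqxx // => w /negPf wv; rewrite vE wv.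
Qed.

Lemma vterm_p v : vterm v ** p v = vterm v.
Proof. by rewrite /vterm cmulDl !cmulZl pp yterm_p. Qed.

(** Only loops could survive in this corner, and [zterm] vanishes on loops. *)
Lemma p_zsum_p v : p v ** zsum ** p v = 0.
Proof.
rewrite /zsum csumMl; last exact: zterm_bounded.
rewrite csumMr; last first.
  by exists (nrm (p v)) => e; apply: le_trans (nrmM _ _) _; rewrite ler_piMr ?nrm_ge0 ?zterm_nrm.
apply: csum0 => e; rewrite /zterm; case: ifPn => [_|]; first by rewrite cmul0r cmul0l.
rewrite /looplike negb_or => /andP[ne _]; have [ve|ve] := eqVneq v (rng e).
  by rewrite -cmulA s_p ?cmul0r // ve eq_sym.
by rewrite p_s // cmul0l.
Qed.

Lemma yterm_mem v : S (yterm v).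
Proof.
have Sp := p_mem v.
have c0 : (kap / 4 : R) != 0 by rewrite mulf_neq0 ?invr_neq0 ?pnatr_eq0 // gt_eqF ?kap_gt0.
have w0 : wgt v != 0 :> R by rewrite gt_eqF // wgt_gt0.
apply: (subalg_scale_inv subS c0); apply: (subalg_scale_inv subS w0).
have -> : (wgt v)%:C *: ((kap / 4 : R)%:C *: yterm v) =
    p v ** single_generator ** p v - (wgt v)%:C *: ((2^-1 : R)%:C *: p v).
  rewrite /single_generator cmulDr p_csum_vterm cmulBr cmulDl cmulBl p_zsum_p.
  have -> : p v ** zsum^# ** p v = 0.
    by rewrite -{1 2}pS -!cstarM cmulA p_zsum_p cstar0.
  by rewrite cmulZl vterm_p subrr addr0 -scalerBr /vterm addrC addKr.
apply: (subalgB subS); last by do 2!apply: (subalgZ subS).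
by do 2?[apply: cstar_subM => //].
Qed.

Lemma rproj_mem e : S (rproj e).
Proof.
set v := rng e; have -> : rproj e = qterm v e by rewrite /qterm eqxx.
have [c c0 yE] := yterm_sqr v.
have Sd : S (dsum v ** dsum v).
  apply: (@subalg_scale_inv _ _ _ subS c); first by rewrite gt_eqF.
  rewrite -yE; apply: cstar_subM => //; last exact: yterm_mem.
  by apply: cstar_subS => //; exact: yterm_mem.
(* All edges serve as index type: those with another range contribute the zero projection. *)
apply: (extract_projections subS (r := fun f => (wgt f / 2)%:C *: qterm v f)).
- move=> f; rewrite /qterm; case: ifP => _; first exact: rproj_projection.
  by split; rewrite ?cstar0 ?cmul0l.
- by move=> f g fg; rewrite /qterm; do 2!case: ifP => _; rewrite ?cmul0l ?cmul0r ?r_orth.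
- by move=> f; rewrite cmulZr /qterm; case: ifP => _; rewrite ?rr ?cmul0l.
- by move=> f; rewrite cmulZl /qterm; case: ifP => _; rewrite ?rr ?cmul0l.
- move=> f; rewrite nrmZ; have := qterm_nrm v f; have := nrm_ge0 (qterm v f).
  have := wgt_gt0 R f; have := wgt_le R f; rewrite /kap => w1 w2.
  rewrite ger0_norm; [nra|lra].
rewrite -dsum_sqr; apply: (subalgZ subS); apply: (subalgB subS) => //.
exact: p_mem.
Qed.

Lemma rproj_zsum e : ~~ looplike e -> rproj e ** zsum = (wgt e)%:C *: s e.
Proof.
move=> e_direct; rewrite /zsum csumMl; last exact: zterm_bounded.
rewrite (csum1 (i := e)) ?/zterm ?(negPf e_direct) ?r_s // => f fe.
by case: ifP => _; rewrite ?cmul0r // r_s0 // eq_sym.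
Qed.

(** A surviving term would come from a direct edge reversing [e]. *)
Lemma rproj_zsum_star e : ~~ looplike e -> rproj e ** zsum^# ** p (src e) = 0.
Proof.
move=> e_direct; have bz := zterm_bounded.
rewrite /zsum csumS // csumMl; last first.
  by have [M zM] := bz; exists M => f; rewrite nrm_star.
rewrite csumMr; last first.
  exists (nrm (rproj e)) => f; apply: le_trans (nrmM _ _) _.
  by rewrite nrm_star ler_piMr ?nrm_ge0 ?zterm_nrm.
apply: csum0 => f; rewrite /zterm; case: ifPn => [_|f_direct].
  by rewrite cstar0 cmul0r cmul0l.
have [ef|ef] := eqVneq (src e) (rng f); last by rewrite -cmulA star_p // cmul0r.
have [fe|fe] := eqVneq (rng e) (src f); last first.
  by rewrite -r_rng -[rproj e ** _ ** _]cmulA p_star // cmul0r cmul0l.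
by case: (direct_no_2cycle e_direct f_direct).
Qed.

Lemma direct_mem e : ~~ looplike e -> S (s e).
Proof.
move=> e_direct.
apply: (@subalg_scale_inv _ _ _ subS (wgt e)); first by rewrite gt_eqF // wgt_gt0.
have -> : (wgt e)%:C *: s e = rproj e ** single_generator ** p (src e).
  rewrite /single_generator cmulDr cmulBr rproj_zsum // cmulDl cmulBl rproj_zsum_star //.
  rewrite cmulZl s_src subr0 -r_rng -[rproj e ** _ ** _]cmulA p_csum_vterm.
  (* The diagonal part lies in the corner of [rng e], and [src e] is another vertex. *)
  rewrite cmulZr cmulZl -vterm_p -!cmulA pw ?cmul0r ?scaler0 ?add0r //.
  by move: e_direct; rewrite /looplike negb_or eq_sym => /andP[].
apply: cstar_subM => //; last exact: p_mem.
by apply: cstar_subM => //; exact: rproj_mem.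
Qed.

(** In both cases [k] equals [s e ** (ell e)^#], so [ell_orth] removes the other terms. It lies in
    [S] because return edges are direct. *)
Lemma lsum_isolate e : looplike e ->
  exists2 k, S k & k ** lsum (src e) = (wgt e)%:C *: s e.
Proof.
move=> e_loop; have bl := lterm_bounded (src e).
have lsumE : lsum (src e) = csum (lterm (src e)).
  by rewrite /lsum; case: asboolP => // -[]; exists e.
have isolate k : k ** ell e = s e ->
    (forall f, looplike f -> f != e -> k ** ell f = 0) ->
    k ** lsum (src e) = (wgt e)%:C *: s e.
  move=> ke kf; rewrite lsumE csumMl // (csum1 (i := e)).
    by rewrite /lterm eqxx e_loop ke.
  move=> f fe; rewrite /lterm; case: ifP => [/andP[_ f_loop]|]; last by rewrite cmul0r.
  exact: kf.
case/orP: (e_loop) => [/eqP ee|e_back].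
  exists (rproj e); first exact: rproj_mem.
  apply: isolate => [|f f_loop fe]; first by rewrite ell_loop // r_s.
  have := ell_orth e_loop f_loop; rewrite eq_sym => /(_ fe).
  by rewrite /rproj -cmulA ell_loop // => ->; rewrite cmul0r.
exists (rproj e ** (s (ret e))^#).
  apply: cstar_subM => //; first exact: rproj_mem.
  by apply: cstar_subS => //; apply: direct_mem; apply: ret_direct.
apply: isolate => [|f f_loop fe]; first by rewrite -cmulA ret_star_ret // r_s.
have := ell_orth e_loop f_loop; rewrite eq_sym => /(_ fe).
by rewrite ell_back // cstarM /rproj -!cmulA => ->; rewrite cmul0r.
Qed.

(** No inverse of [dsum v] is formed: it acts on [qterm v f] as the scalar [1 + wgt f], which puts
    each [s e ** qterm v f] in [S]. Summing gives [s e ** qsum v], the difference between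
    [s e ** dsum v] and [s e]. *)
Lemma looplike_mem e : looplike e -> S (s e).
Proof.
move=> e_loop; have [k Sk kE] := lsum_isolate e_loop; set v := src e in kE.
have Sd : S (s e ** dsum v).
  apply: (@subalg_scale_inv _ _ _ subS (wgt e)); first by rewrite gt_eqF // wgt_gt0.
  rewrite -cmulZl -kE -cmulA; apply: cstar_subM => //; exact: yterm_mem.
have dq f : dsum v ** qterm v f = (1 + wgt f)%:C *: qterm v f.
  rewrite scale_realD scale1r /dsum cmulDl qsum_qterm; congr (_ + _).
  by rewrite /qterm; case: ifP => [/eqP <-|]; rewrite ?rng_r ?cmul0r.
have Ssq f : S (s e ** qterm v f).
  apply: (@subalg_scale_inv _ _ _ subS (1 + wgt f)).
    by rewrite gt_eqF // addr_gt0 ?wgt_gt0.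
  rewrite -cmulZr -dq cmulA; apply: cstar_subM => //.
  rewrite /qterm; case: ifP => _; first exact: rproj_mem.
  exact: (cstar_sub0 subS).
have -> : s e = s e ** dsum v - s e ** qsum v.
  by rewrite -cmulBr /dsum addrK s_src.
apply: (subalgB subS) => //; rewrite /qsum csumMl; last exact: qterm_bounded.
apply: (csum_mem subS) => //.
exists (nrm (s e)) => f; apply: le_trans (nrmM _ _) _.
by rewrite ler_piMr ?nrm_ge0 ?qterm_nrm.
Qed.

Lemma s_mem e : S (s e).
Proof.
by have [e_loop|e_direct] := boolP (looplike e); [exact: looplike_mem|exact: direct_mem].
Qed.

End Membership.

End CuntzKrieger.

Theorem theorem1 (R : realType) (E : digraph) (A : cstarAlg R)
    (p : vertex E -> A) (s : edge E -> A)
    (hA : is_graph_cstar_algebra p s) :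
  exists x : A, cstar_generated [set x] = [set: A].
Proof.
exists (single_generator p s); apply/seteqP; split=> // a _ S [subS Sx].
have Sgen : S (single_generator p s) by exact: Sx.
have : cstar_generated (range p `|` range s) a by rewrite (graph_gen hA).
apply; split=> // b [[v _ <-]|[e _ <-]].
- exact: (p_mem (graph_ck hA) subS Sgen).
- exact: (s_mem (graph_ck hA) subS Sgen).
Qed.
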